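(* Let $\alpha,\beta$ be Martin-Löf random left-c.e. reals and let $\mathcal{D}(\alpha,\beta)=\inf\{q\in\mathbb{Q}^+ : q\alpha-\beta \text{ is a left-c.e. real}\}$. Then: (a) if $\mathcal{D}(\alpha,\beta)<1$ then $\alpha-\beta$ is a Martin-Löf random left-c.e. real; (b) if $\mathcal{D}(\alpha,\beta)=1$ then $\alpha-\beta$ is not Martin-Löf random; (c) if $\mathcal{D}(\alpha,\beta)>1$ then $\alpha-\beta$ is a Martin-Löf random right-c.e. real.
   Context: A real is left-c.e. if it is the limit of a computable increasing sequence of rationals, and right-c.e. if it is the limit of a computable decreasing sequence of rationals. $\mathbb{Q}^+$ denotes the positive rationals. A real is Martin-Löf random if (the binary expansion of its fractional part) is Martin-Löf random. *)

(* Defs.v *)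
From Stdlib Require Import Reals List Arith PArith QArith.
From Coquelicot Require Import Rbar Lub.
Import ListNotations.
Open Scope R_scope.

Inductive code : Type :=
| CZero : code
| CSucc : code
| CProj : nat -> code
| CComp : code -> list code -> code
| CPrec : code -> code -> code
| CMu   : code -> code.

Inductive eval : code -> list nat -> nat -> Prop :=
| eZero v : eval CZero v 0
| eSucc x v : eval CSucc (x :: v) (S x)
| eProj i v : (i < length v)%nat -> eval (CProj i) v (nth i v 0%nat)
| eComp f gs v ws y : evals gs v ws -> eval f ws y -> eval (CComp f gs) v y
| ePrec0 f g v y : eval f v y -> eval (CPrec f g) (0%nat :: v) y
| ePrecS f g n v r y :
    eval (CPrec f g) (n :: v) r -> eval g (n :: r :: v) y ->
    eval (CPrec f g) (S n :: v) y
| eMu f v n :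
    eval f (n :: v) 0 ->
    (forall m, (m < n)%nat -> exists k, eval f (m :: v) (S k)) ->
    eval (CMu f) v n
with evals : list code -> list nat -> list nat -> Prop :=
| esNil v : evals nil v nil
| esCons g gs v w ws : eval g v w -> evals gs v ws -> evals (g :: gs) v (w :: ws).

Definition computable1 (f : nat -> nat) : Prop :=
  exists c, forall n, eval c [n] (f n).
Definition computable2 (f : nat -> nat -> nat) : Prop :=
  exists c, forall n m, eval c [n; m] (f n m).

Definition computable_rat_seq (r : nat -> R) : Prop :=
  exists a b d : nat -> nat,
    computable1 a /\ computable1 b /\ computable1 d /\
    forall n, r n = (INR (a n) - INR (b n)) / INR (S (d n)).

Definition left_ce (x : R) : Prop :=
  exists r, computable_rat_seq r /\ (forall n, r n <= r (S n)) /\ Un_cv r x.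
Definition right_ce (x : R) : Prop :=
  exists r, computable_rat_seq r /\ (forall n, r (S n) <= r n) /\ Un_cv r x.

Fixpoint pbits (p : positive) : list bool :=
  match p with
  | xH => []
  | xO p => pbits p ++ [false]
  | xI p => pbits p ++ [true]
  end.

(* bijection nat -> list bool: c |-> binary expansion of c+1 without leading 1 *)
Definition decode_str (c : nat) : list bool := pbits (Pos.of_succ_nat c).

Fixpoint prefixb (s t : list bool) : bool :=
  match s, t with
  | [], _ => true
  | a :: s', b :: t' => Bool.eqb a b && prefixb s' t'
  | _ :: _, [] => false
  end.

Fixpoint all_strings (n : nat) : list (list bool) :=
  match n with
  | O => [[]]
  | S n => flat_map (fun s => [false :: s; true :: s]) (all_strings n)
  end.

(* Lebesgue measure of the finite union of cylinders [s], s in S: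
   fraction of strings of length L = max length extending some s in S. *)
Definition cyl_measure (S : list (list bool)) : R :=
  let L := fold_right (fun s m => Nat.max (length s) m) 0%nat S in
  INR (length (filter (fun t => existsb (fun s => prefixb s t) S) (all_strings L)))
  / (2 ^ L).

Definition is_prefix (s : list bool) (X : nat -> bool) : Prop :=
  forall i, (i < length s)%nat -> nth i s false = X i.

(* A Martin-Loef test is given by a computable T : nat -> nat -> nat;
   U_n is enumerated by k |-> T n k, where 0 means "no string" and
   (S c) means the string decode_str c. *)
Definition test_stage (T : nat -> nat -> nat) (n k : nat) : list (list bool) :=
  flat_map (fun j => match T n j with O => [] | S c => [decode_str c] end)
           (seq 0 k).

(* measure of [U_n] <= 2^-n  (the measure of the increasing union is the
   supremum of the measures of the finite stages) *)
Definition ML_test (T : nat -> nat -> nat) : Prop :=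
  computable2 T /\ forall n k, cyl_measure (test_stage T n k) <= (/ 2) ^ n.

Definition fails_test (T : nat -> nat -> nat) (X : nat -> bool) : Prop :=
  forall n, exists k c, T n k = S c /\ is_prefix (decode_str c) X.

Definition ML_random_seq (X : nat -> bool) : Prop :=
  forall T, ML_test T -> ~ fails_test T X.

(* binary expansion of the fractional part of x (the expansion not ending
   in 1^omega): bit i = floor(frac(x) * 2^(i+1)) mod 2 *)
Definition frac_bits (x : R) : nat -> bool :=
  fun i => Z.odd (Int_part (frac_part x * 2 ^ (S i))).

Definition ML_random (x : R) : Prop := ML_random_seq (frac_bits x).

Definition Dset (alpha beta : R) : R -> Prop :=
  fun r => exists q : Q, (0 < q)%Q /\ r = Q2R q /\ left_ce (r * alpha - beta).

Definition D (alpha beta : R) : Rbar := Glb_Rbar (Dset alpha beta).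

(* Main.v *)
(* Fix increasing computable approximations a_s of alpha and b_s of beta.
   Every randomness argument covers a real by the following pouring process:
   whenever one sequence increases, a proportional amount of measure is poured
   onto the line at the current point of the other one, filling the first
   uncovered place to its right.  The covered set ahead of the current point is
   then a single interval, and if the second sequence is slower than the first
   from some stage on (up to the factor of proportionality), then its limit gets
   covered.
   One such step gives Kucera-Slaman: a random left-c.e. real gamma satisfies
   "c gamma - alpha is left-c.e." for some c.  Iterating it back and forth
   between alpha and beta shows that, for q < p, the ratio
   (beta - b_s) / (alpha - a_s) cannot be infinitely often below q and infinitely
   often above p, each round trip shrinking the cover of alpha by q / p.  Hence
   beta - q alpha is left-c.e. whenever q < p < D, and (a), (c) follow because
   adding a left-c.e. real to a random left-c.e. one preserves randomness.
   For (b), a random alpha - beta is left-c.e. or right-c.e., since the steps of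
   its approximation form a Solovay test; Kucera-Slaman applied to it then
   contradicts D = 1 or makes alpha computable. *)
Require Import Defs.
From Stdlib Require Import Reals ZArith QArith Qreals List Arith Lia Lra Classical.
From Coquelicot Require Import Rbar Lub.
Import ListNotations.
Open Scope R_scope.

(** * Computable functions of several variables *)

(* The innermost variable comes first in the encoding, where [CPrec] expects
   its recursion argument. *)
Class ctx (X : Type) := {
  enc : X -> list nat;
  arity : nat;
  enc_length : forall x, length (enc x) = arity }.

#[export] Instance ctx_nat : ctx nat.
Proof. exists (fun n => [n]) 1%nat; reflexivity. Defined.

#[export] Instance ctx_prod (X : Type) (CX : ctx X) : ctx (X * nat).
Proof.
  exists (fun y => snd y :: enc (fst y)) (S (arity (X := X))).
  intros y; cbn; now rewrite enc_length.
Defined.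

Definition computable {X} {CX : ctx X} (f : X -> nat) : Prop :=
  exists c, forall x, eval c (enc x) (f x).

Definition computable_map {X Y} {CX : ctx X} {CY : ctx Y} (g : X -> Y) : Prop :=
  exists cs, forall x, evals cs (enc x) (enc (g x)).

Definition computable2_on (f : nat -> nat -> nat) : Prop :=
  computable (fun y : nat * nat => f (fst y) (snd y)).

Section Contexts.
Context {X Y : Type} {CX : ctx X} {CY : ctx Y}.
Implicit Types f g h : X -> nat.

Lemma cp_ext f g : (forall x, f x = g x) -> computable f -> computable g.
Proof. intros E [c H]; exists c; intros x; rewrite <- E; apply H. Qed.

Lemma cp_comp (f : Y -> nat) (g : X -> Y) : computable f -> computable_map g -> computable (fun x => f (g x)).
Proof.
  intros [c Hc] [cs Hcs]; exists (CComp c cs); intros x.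
  econstructor; [apply Hcs | apply Hc].
Qed.

Lemma cpm_nat f : computable f -> computable_map f.
Proof. intros [c H]; exists [c]; intros x; repeat constructor; apply H. Qed.

Lemma cpm_pair (g : X -> Y) f : computable_map g -> computable f -> computable_map (fun x => (g x, f x)).
Proof.
  intros [cs Hs] [c H]; exists (c :: cs); intros x; cbn.
  constructor; [apply H | apply Hs].
Qed.

Lemma evals_proj v w :
  evals (map CProj (seq (length w) (length v))) (w ++ v) v.
Proof.
  revert w; induction v as [|a v IH]; intros w; cbn; [constructor|].
  constructor.
  - replace a with (nth (length w) (w ++ a :: v) 0%nat) at 2
      by (rewrite app_nth2, Nat.sub_diag by lia; reflexivity).
    constructor; rewrite length_app; cbn; lia.
  - specialize (IH (w ++ [a])). rewrite length_app, <- app_assoc in IH; cbn in IH.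
    now rewrite Nat.add_1_r in IH.
Qed.

Lemma cpm_id : computable_map (fun x : X => x).
Proof.
  exists (map CProj (seq 0 (arity (X := X)))); intros x.
  rewrite <- (enc_length x); exact (evals_proj (enc x) []).
Qed.

Lemma cpm_fst : computable_map (fun y : X * nat => fst y).
Proof.
  exists (map CProj (seq 1 (arity (X := X)))); intros y.
  rewrite <- (enc_length (fst y)); exact (evals_proj (enc (fst y)) [snd y]).
Qed.

Lemma cp_snd : computable (fun y : X * nat => snd y).
Proof. exists (CProj 0); intros y; apply (eProj 0 (snd y :: enc (fst y))); cbn; lia. Qed.

Lemma cp_S f : computable f -> computable (fun x => S (f x)).
Proof.
  intros [c H]; exists (CComp CSucc [c]); intros x.
  econstructor; [repeat constructor; apply H | constructor].
Qed.

Lemma cp_const n : computable (fun _ : X => n).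
Proof.
  induction n as [|n IH]; [exists CZero; intros; constructor | now apply cp_S].
Qed.

(** The step is judged on triples ((x, r), n) because [CPrec] runs its step code on n :: r :: v and
    the last component of a context is encoded first. *)
Lemma cp_nat_rect (b k : X -> nat) (s : X -> nat -> nat -> nat) :
  computable b -> computable (fun y : X * nat * nat => s (fst (fst y)) (snd y) (snd (fst y))) ->
  computable k -> computable (fun x => nat_rect (fun _ => nat) (b x) (s x) (k x)).
Proof.
  intros [cb Hb] [cs Hs] [ck Hk].
  exists (CComp (CPrec cb cs) (ck :: map CProj (seq 0 (arity (X := X))))); intros x.
  econstructor.
  - constructor; [apply Hk|].
    rewrite <- (enc_length x); exact (evals_proj (enc x) []).
  - induction (k x) as [|n IH]; cbn; [constructor; apply Hb|].
    econstructor; [apply IH|]. exact (Hs ((x, _), n)).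
Qed.

End Contexts.

Lemma cpm_fst_comp {X Y} {CX : ctx X} {CY : ctx Y} (g : X -> Y) :
  computable_map g -> computable_map (fun y : X * nat => g (fst y)).
Proof.
  intros [cs Hcs]; destruct (cpm_fst (X := X)) as [ps Hps].
  exists (map (fun c => CComp c ps) cs); intros y.
  specialize (Hps y); specialize (Hcs (fst y)).
  induction Hcs; cbn; constructor; auto; econstructor; eauto.
Qed.

Lemma cp_id : computable (fun x : nat => x).
Proof. exists (CProj 0); intros x; apply (eProj 0 [x]); cbn; lia. Qed.

Lemma cp_fst_comp {X} {CX : ctx X} (f : X -> nat) :
  computable f -> computable (fun y : X * nat => f (fst y)).
Proof. intros H; exact (cp_comp f _ H cpm_fst). Qed.

Lemma cp_app2 {X} {CX : ctx X} (f : nat -> nat -> nat) (g h : X -> nat) :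
  computable2_on f -> computable g -> computable h -> computable (fun x => f (g x) (h x)).
Proof.
  intros Hf Hg Hh.
  exact (cp_comp _ (fun x => (g x, h x)) Hf (cpm_pair _ _ (cpm_nat _ Hg) Hh)).
Qed.

Ltac cpm_proj :=
  match goal with
  | |- computable_map (fun y => y) => apply cpm_id
  | |- computable_map (fun y => fst y) => apply cpm_fst
  | |- @computable_map _ _ _ _ (@fst _ _) => apply cpm_fst
  | |- computable_map (fun y => fst (fst y)) => apply (cpm_fst_comp (fun x => fst x)); cpm_proj
  | |- computable_map (fun y => fst (fst (fst y))) =>
      apply (cpm_fst_comp (fun x => fst (fst x))); cpm_proj
  end.

Ltac cpm_tac :=
  first [ cpm_proj | apply cpm_pair; [cpm_tac |] | apply cpm_nat ].

Ltac cp_var :=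
  match goal with
  | |- computable (fun y => y) => apply cp_id
  | |- computable (fun y => snd y) => apply cp_snd
  | |- @computable _ _ (@snd _ _) => apply cp_snd
  | |- @computable _ _ (@fst _ _) => apply (cp_fst_comp (fun x => x)); apply cp_id
  | |- computable (fun y => fst y) => apply (cp_fst_comp (fun x => x)); apply cp_id
  | |- computable (fun y => snd (fst y)) =>
      apply (cp_fst_comp (fun x => snd x)); cp_var
  | |- computable (fun y => fst (fst y)) =>
      apply (cp_fst_comp (fun x => fst x)); cp_var
  | |- computable (fun y => snd (fst (fst y))) =>
      apply (cp_fst_comp (fun x => snd (fst x))); cp_var
  | |- computable (fun y => fst (fst (fst y))) =>
      apply (cp_fst_comp (fun x => fst (fst x))); cp_var
  | |- computable (fun y => snd (fst (fst (fst y)))) =>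
      apply (cp_fst_comp (fun x => snd (fst (fst x)))); cp_var
  | |- computable (fun y => fst (fst (fst (fst y)))) =>
      apply (cp_fst_comp (fun x => fst (fst (fst x)))); cp_var
  | |- computable (fun y => fst (fst (fst (fst (fst y))))) =>
      apply (cp_fst_comp (fun x => fst (fst (fst (fst x))))); cp_var
  | |- computable (fun y => snd (fst (fst (fst (fst y))))) =>
      apply (cp_fst_comp (fun x => snd (fst (fst (fst x))))); cp_var
  end.

Create HintDb cpdb.

(** A hook for conditionals, filled in once [cp_if_le] is available. *)
Ltac cp_extra := fail.

Ltac cp_step :=
  match goal with
  | |- computable (fun _ => ?n) => apply cp_const
  | |- computable _ => cp_var
  | H : computable ?f |- computable ?f => exact H
  | H : computable ?f |- computable (fun x => ?f x) => exact H
  | |- computable (fun x => S _) => apply cp_S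
  | |- @computable nat _ S => apply (cp_S (fun n => n))
  | |- computable (fun x => if (_ <=? _)%nat then _ else _) => cp_extra
  | H : computable ?f |- computable (fun x => ?f (@?g x)) => apply (cp_comp f g H); cpm_tac
  | |- computable (fun x => nat_rect (fun _ => nat) (@?b x) (@?s x) (@?k x)) =>
      apply (cp_nat_rect b k s)
  | |- computable (fun x => ?f (@?g x) (@?h x)) =>
      apply (cp_app2 f g h); [solve [assumption | auto with cpdb] | |]
  | |- computable (fun x => ?f (@?g x)) =>
      apply (cp_comp f g); [solve [auto with cpdb] | cpm_tac]
  end; cbv beta; cbn [fst snd].
Ltac cps := repeat cp_step.

Lemma cp2_add : computable2_on Nat.add.
Proof.
  apply (cp_ext (fun y : nat * nat =>
    nat_rect (fun _ => nat) (snd y) (fun _ r => S r) (fst y))).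
  - intros [a b]; cbn; induction a; cbn; auto.
  - cps.
Qed.
#[export] Hint Resolve cp2_add : cpdb.

Lemma cp2_mul : computable2_on Nat.mul.
Proof.
  apply (cp_ext (fun y : nat * nat =>
    nat_rect (fun _ => nat) 0%nat (fun _ r => (snd y + r)%nat) (fst y))).
  - intros [a b]; cbn; induction a; cbn; auto.
  - cps.
Qed.
#[export] Hint Resolve cp2_mul : cpdb.

Lemma cp_pred : computable Nat.pred.
Proof.
  apply (cp_ext (fun y : nat => nat_rect (fun _ => nat) 0%nat (fun n _ => n) y)).
  - intros [|a]; reflexivity.
  - cps.
Qed.
#[export] Hint Resolve cp_pred : cpdb.

Lemma cp2_sub : computable2_on Nat.sub.
Proof.
  apply (cp_ext (fun y : nat * nat =>
    nat_rect (fun _ => nat) (fst y) (fun _ r => Nat.pred r) (snd y))).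
  - intros [a b]; cbn; induction b; cbn; lia.
  - cps.
Qed.
#[export] Hint Resolve cp2_sub : cpdb.

Lemma cp_if_le {X} {CX : ctx X} (a b f g : X -> nat) :
  computable a -> computable b -> computable f -> computable g ->
  computable (fun x => if (a x <=? b x)%nat then f x else g x).
Proof.
  intros.
  (* Truncated subtraction vanishes exactly when a x <= b x, so recursion on it decides the
     comparison. *)
  apply (cp_ext (fun x =>
    nat_rect (fun _ => nat) (f x) (fun _ _ => g x) (a x - b x)%nat)).
  - intros x; destruct (Nat.leb_spec (a x) (b x)).
    + now replace (a x - b x)%nat with 0%nat by lia.
    + now replace (a x - b x)%nat with (S (a x - b x - 1)) by lia.
  - cps.
Qed.

Ltac cp_extra ::= apply cp_if_le.

Lemma cp2_pow : computable2_on Nat.pow.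
Proof.
  apply (cp_ext (fun y : nat * nat =>
    nat_rect (fun _ => nat) 1%nat (fun _ r => (fst y * r)%nat) (snd y))).
  - intros [a b]; cbn; induction b; cbn; auto.
  - cps.
Qed.
#[export] Hint Resolve cp2_pow : cpdb.

Lemma cp_log2 : computable Nat.log2.
Proof.
  (* From n to S n the logarithm grows by at most one; comparing with the next power of 2 decides
     whether it does. *)
  apply (cp_ext (fun n : nat => nat_rect (fun _ => nat) 0%nat
    (fun n r => if (2 ^ S r <=? S n)%nat then S r else r) n)).
  - intros n; induction n as [|n IH]; [reflexivity|].
    cbn [nat_rect]; rewrite IH; symmetry.
    destruct n as [|n]; [reflexivity|].
    pose proof (Nat.log2_spec (S n) ltac:(lia)) as [H1 H2].
    set (e := Nat.log2 (S n)) in *.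
    pose proof (Nat.pow_succ_r' 2 (S e)).
    destruct (Nat.leb_spec (2 ^ S e) (S (S n))); apply Nat.log2_unique; lia.
  - cps.
Qed.
#[export] Hint Resolve cp_log2 : cpdb.

Lemma cp_sqrt : computable Nat.sqrt.
Proof.
  apply (cp_ext (fun n : nat => nat_rect (fun _ => nat) 0%nat
    (fun n r => if (S r * S r <=? S n)%nat then S r else r) n)).
  - intros n; induction n as [|n IH]; [reflexivity|].
    cbn [nat_rect]; rewrite IH; symmetry.
    pose proof (Nat.sqrt_spec n ltac:(lia)) as [H1 H2].
    set (e := Nat.sqrt n) in *.
    destruct (Nat.leb_spec (S e * S e) (S n)); apply Nat.sqrt_unique; lia.
  - cps.
Qed.
#[export] Hint Resolve cp_sqrt : cpdb.

(* [code_pair] is injective but not surjective. *)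
Definition code_pair (a b : nat) : nat := ((a + b) * (a + b) + a)%nat.
Definition code_fst (n : nat) : nat := (n - Nat.sqrt n * Nat.sqrt n)%nat.
Definition code_snd (n : nat) : nat := (Nat.sqrt n - code_fst n)%nat.

Lemma sqrt_pair a b : Nat.sqrt (code_pair a b) = (a + b)%nat.
Proof. apply Nat.sqrt_unique; unfold code_pair; lia. Qed.

Lemma code_fst_pair a b : code_fst (code_pair a b) = a.
Proof. unfold code_fst; rewrite sqrt_pair; unfold code_pair; lia. Qed.

Lemma code_snd_pair a b : code_snd (code_pair a b) = b.
Proof. unfold code_snd; rewrite code_fst_pair, sqrt_pair; lia. Qed.

Lemma cp2_code_pair : computable2_on code_pair.
Proof. unfold computable2_on, code_pair; cps. Qed.
Lemma cp_code_fst : computable code_fst.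
Proof. unfold code_fst; cps. Qed.
#[export] Hint Resolve cp2_code_pair cp_code_fst : cpdb.
Lemma cp_code_snd : computable code_snd.
Proof. unfold code_snd; cps. Qed.
#[export] Hint Resolve cp_code_snd : cpdb.

(** * Computable rational-valued functions *)

Definition frac (a b d : nat) : R := (INR a - INR b) / INR (S d).
(** Every number codes a rational, so recursions can carry rationals as codes without a validity
    condition. *)
Definition val (c : nat) : R := frac (code_fst c) (code_fst (code_snd c)) (code_snd (code_snd c)).

Definition computable_rat {X} {CX : ctx X} (r : X -> R) : Prop :=
  exists c : X -> nat, computable c /\ forall x, r x = val (c x).

Definition computable_rat2 (r : nat -> nat -> R) : Prop :=
  computable_rat (fun y : nat * nat => r (fst y) (snd y)).

Lemma INR_S_pos d : 0 < INR (S d).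
Proof. apply lt_0_INR; lia. Qed.

Lemma frac_le a b d a' b' d' : frac a b d <= frac a' b' d' <->
  (a * S d' + b' * S d <= a' * S d + b * S d')%nat.
Proof.
  unfold frac; pose proof (INR_S_pos d) as P; pose proof (INR_S_pos d') as P'.
  split; intros L.
  - apply INR_le; rewrite !plus_INR, !mult_INR.
    apply (Rmult_le_compat_r (INR (S d) * INR (S d'))) in L; [|nra].
    replace ((INR a - INR b) / INR (S d) * (INR (S d) * INR (S d')))
      with ((INR a - INR b) * INR (S d')) in L by (field; lra).
    replace ((INR a' - INR b') / INR (S d') * (INR (S d) * INR (S d')))
      with ((INR a' - INR b') * INR (S d)) in L by (field; lra).
    lra.
  - apply le_INR in L; rewrite !plus_INR, !mult_INR in L.
    apply (Rmult_le_reg_r (INR (S d) * INR (S d'))); [nra|].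
    replace ((INR a - INR b) / INR (S d) * (INR (S d) * INR (S d')))
      with ((INR a - INR b) * INR (S d')) by (field; lra).
    replace ((INR a' - INR b') / INR (S d') * (INR (S d) * INR (S d')))
      with ((INR a' - INR b') * INR (S d)) by (field; lra).
    lra.
Qed.

Section Crs.
Context {X : Type} {CX : ctx X}.
Implicit Types r s t : X -> R.

Lemma crs_ext r s : (forall x, r x = s x) -> computable_rat r -> computable_rat s.
Proof. intros E (c & Hc & H); exists c; split; auto; intros x; now rewrite <- E. Qed.

Lemma crs_comp {Y} {CY : ctx Y} (r : Y -> R) (g : X -> Y) :
  computable_rat r -> computable_map g -> computable_rat (fun x => r (g x)).
Proof.
  intros (c & Hc & H) Hg; exists (fun x => c (g x)); split; auto.
  now apply cp_comp.
Qed.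

Lemma crs_app2 (r : nat -> nat -> R) (g h : X -> nat) :
  computable_rat2 r -> computable g -> computable h -> computable_rat (fun x => r (g x) (h x)).
Proof.
  intros Hf Hg Hh.
  exact (crs_comp _ (fun x => (g x, h x)) Hf (cpm_pair _ _ (cpm_nat _ Hg) Hh)).
Qed.

Lemma crs_frac (a b d : X -> nat) :
  computable a -> computable b -> computable d -> computable_rat (fun x => frac (a x) (b x) (d x)).
Proof.
  intros; exists (fun x => code_pair (a x) (code_pair (b x) (d x))); split; [cps|].
  intros x; unfold val; now rewrite !code_snd_pair, !code_fst_pair.
Qed.

Lemma crs_inv r : computable_rat r -> exists a b d,
  computable a /\ computable b /\ computable d /\ forall x, r x = frac (a x) (b x) (d x).
Proof.
  intros (c & Hc & H).
  exists (fun x => code_fst (c x)), (fun x => code_fst (code_snd (c x))),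
    (fun x => code_snd (code_snd (c x))).
  repeat split; [cps | cps | cps | exact H].
Qed.

Lemma crs_plus r s : computable_rat r -> computable_rat s -> computable_rat (fun x => r x + s x).
Proof.
  intros (a & b & d & Ha & Hb & Hd & E)%crs_inv (a' & b' & d' & Ha' & Hb' & Hd' & E')%crs_inv.
  apply (crs_ext (fun x => frac (a x * S (d' x) + a' x * S (d x))
     (b x * S (d' x) + b' x * S (d x)) (d x * d' x + d x + d' x))).
  - intros x; rewrite E, E'; unfold frac.
    replace (S (d x * d' x + d x + d' x)) with (S (d x) * S (d' x))%nat by lia.
    rewrite !plus_INR, !mult_INR.
    pose proof (INR_S_pos (d x)); pose proof (INR_S_pos (d' x)); field; lra.
  - apply crs_frac; cps.
Qed.

Lemma crs_mult r s : computable_rat r -> computable_rat s -> computable_rat (fun x => r x * s x).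
Proof.
  intros (a & b & d & Ha & Hb & Hd & E)%crs_inv (a' & b' & d' & Ha' & Hb' & Hd' & E')%crs_inv.
  apply (crs_ext (fun x => frac (a x * a' x + b x * b' x)
     (b x * a' x + a x * b' x) (d x * d' x + d x + d' x))).
  - intros x; rewrite E, E'; unfold frac.
    replace (S (d x * d' x + d x + d' x)) with (S (d x) * S (d' x))%nat by lia.
    rewrite !plus_INR, !mult_INR.
    pose proof (INR_S_pos (d x)); pose proof (INR_S_pos (d' x)); field; lra.
  - apply crs_frac; cps.
Qed.

Lemma crs_opp r : computable_rat r -> computable_rat (fun x => - r x).
Proof.
  intros (a & b & d & Ha & Hb & Hd & E)%crs_inv.
  apply (crs_ext (fun x => frac (b x) (a x) (d x))).
  - intros x; rewrite E; unfold frac; pose proof (INR_S_pos (d x)); field; lra.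
  - apply crs_frac; cps.
Qed.

Lemma crs_minus r s : computable_rat r -> computable_rat s -> computable_rat (fun x => r x - s x).
Proof. intros; apply (crs_plus r (fun x => - s x)); auto using crs_opp. Qed.

Lemma crs_INR (f : X -> nat) : computable f -> computable_rat (fun x => INR (f x)).
Proof.
  intros; apply (crs_ext (fun x => frac (f x) 0 0)).
  - intros x; unfold frac; cbn [INR]; field.
  - apply crs_frac; cps.
Qed.

Lemma crs_inv_S (f : X -> nat) : computable f -> computable_rat (fun x => / INR (S (f x))).
Proof.
  intros; apply (crs_ext (fun x => frac 1 0 (f x))).
  - intros x; unfold frac; pose proof (INR_S_pos (f x)).
    change (INR 1) with 1; change (INR 0) with 0; field; lra.
  - apply crs_frac; cps.
Qed.

Lemma crs_IZR z : computable_rat (fun _ : X => IZR z).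
Proof.
  assert (H : forall n : nat, computable_rat (fun _ : X => INR n)) by (intros; apply crs_INR; cps).
  destruct z as [|p|p].
  - apply (H 0%nat).
  - apply (crs_ext (fun _ : X => INR (Pos.to_nat p))); auto.
    intros; now rewrite INR_IZR_INZ, positive_nat_Z.
  - apply (crs_ext (fun _ : X => - INR (Pos.to_nat p))); auto using crs_opp.
    intros; rewrite INR_IZR_INZ, positive_nat_Z; symmetry; apply (opp_IZR (Z.pos p)).
Qed.

Lemma crs_Q2R q : computable_rat (fun _ : X => Q2R q).
Proof.
  apply (crs_ext (fun _ : X => IZR (Qnum q) * / INR (S (pred (Pos.to_nat (Qden q)))))).
  - intros _; unfold Q2R; do 2 f_equal.
    rewrite Nat.succ_pred_pos by apply Pos2Nat.is_pos.
    now rewrite INR_IZR_INZ, positive_nat_Z.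
  - apply crs_mult; [apply crs_IZR | apply crs_inv_S; cps].
Qed.

(** On coded rationals [Rle_dec] agrees with a test on natural numbers, by cross multiplication. *)
Lemma cp_if_Rle r s (f g : X -> nat) : computable_rat r -> computable_rat s -> computable f -> computable g ->
  computable (fun x => if Rle_dec (r x) (s x) then f x else g x).
Proof.
  intros (a & b & d & Ha & Hb & Hd & E)%crs_inv (a' & b' & d' & Ha' & Hb' & Hd' & E')%crs_inv Hf Hg.
  apply (cp_ext (fun x =>
    if (a x * S (d' x) + b' x * S (d x) <=? a' x * S (d x) + b x * S (d' x))%nat
    then f x else g x)); [|cps].
  intros x; rewrite E, E'.
  destruct (Nat.leb_spec (a x * S (d' x) + b' x * S (d x)) (a' x * S (d x) + b x * S (d' x)))
    as [L|L]; destruct (Rle_dec _ _) as [L'|L']; auto; exfalso; rewrite frac_le in L'; lia.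
Qed.

Lemma crs_if_Rle r s t t' : computable_rat r -> computable_rat s -> computable_rat t -> computable_rat t' ->
  computable_rat (fun x => if Rle_dec (r x) (s x) then t x else t' x).
Proof.
  intros Hr Hs (c & Hc & E) (c' & Hc' & E').
  exists (fun x => if Rle_dec (r x) (s x) then c x else c' x); split.
  - now apply cp_if_Rle.
  - intros x; destruct (Rle_dec _ _); auto.
Qed.

Lemma crs_if_le (a b : X -> nat) r s : computable a -> computable b -> computable_rat r -> computable_rat s ->
  computable_rat (fun x => if (a x <=? b x)%nat then r x else s x).
Proof.
  intros Ha Hb (c & Hc & E) (c' & Hc' & E').
  exists (fun x => if (a x <=? b x)%nat then c x else c' x); split; [cps|].
  intros x; destruct (a x <=? b x)%nat; auto.
Qed.

Lemma crs_Rmax r s : computable_rat r -> computable_rat s -> computable_rat (fun x => Rmax (r x) (s x)).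
Proof. intros; now apply crs_if_Rle. Qed.

Lemma crs_Rmin r s : computable_rat r -> computable_rat s -> computable_rat (fun x => Rmin (r x) (s x)).
Proof. intros; now apply crs_if_Rle. Qed.

Lemma crs_val (f : X -> nat) : computable f -> computable_rat (fun x => val (f x)).
Proof. intros; now exists f. Qed.

(** The recursion runs on codes, which is why G is only required to be computable at values of
    [val]. *)
Lemma crs_rec (r : X -> nat -> R) (G : X -> nat -> R -> R) :
  (forall x n, r x (S n) = G x n (r x n)) ->
  computable_rat (fun x => r x 0%nat) ->
  computable_rat (fun y : X * nat * nat => G (fst (fst y)) (snd y) (val (snd (fst y)))) ->
  computable_rat (fun y : X * nat => r (fst y) (snd y)).
Proof.
  intros HS (b & Hb & E0) (g & Hg & E).
  exists (fun y => nat_rect (fun _ => nat) (b (fst y))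
    (fun n c => g ((fst y, c), n)) (snd y)); split.
  - apply (cp_nat_rect (fun y : X * nat => b (fst y)) snd
      (fun (y : X * nat) n c => g ((fst y, c), n))).
    + now apply cp_fst_comp.
    + apply (cp_comp g); auto.
      apply cpm_pair; [apply cpm_pair|]; repeat first [cpm_proj | cp_step].
    + cps.
  - intros [x n]; cbn; induction n as [|n IH]; cbn; [apply E0|].
    rewrite HS, IH; apply (E ((x, _), n)).
Qed.

End Crs.

Lemma crs_half {X} {CX : ctx X} : computable_rat (fun _ : X => / 2).
Proof. apply (crs_inv_S (fun _ => 1%nat)); cps. Qed.

Lemma crs_pow {X} {CX : ctx X} (c : R) (f : X -> nat) :
  computable_rat (fun _ : nat => c) -> computable f -> computable_rat (fun x => c ^ f x).
Proof.
  intros Hc Hf.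
  assert (H : computable_rat (fun y : nat * nat => (fun _ n => c ^ n) (fst y) (snd y))).
  { apply (crs_rec (X := nat) (fun _ n => c ^ n) (fun _ _ r => c * r)); [reflexivity| |]; cbn.
    - exact (crs_IZR 1).
    - apply crs_mult; [|apply crs_val; cps].
      apply (crs_comp _ (fun _ => 0%nat) Hc); apply cpm_nat; cps. }
  apply (crs_app2 (fun _ n => c ^ n) f f H); auto.
Qed.

Ltac crs_step :=
  match goal with
  | |- computable_rat (fun x => IZR _) => apply crs_IZR
  | |- computable_rat (fun x => / 2) => apply crs_half
  | |- computable_rat (fun x => _ ^ _) => apply crs_pow; [| cps]
  | |- computable_rat (pow ?c) => apply (crs_pow c (fun n => n)); [| cps]
  | |- computable_rat (fun x => Q2R _) => apply crs_Q2R
  | H : computable_rat ?r |- computable_rat ?r => exact H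
  | H : computable_rat ?r |- computable_rat (fun x => ?r x) => exact H
  | |- computable_rat (fun x => _ + _) => apply crs_plus
  | |- computable_rat (fun x => _ - _) => apply crs_minus
  | |- computable_rat (fun x => _ * _) => apply crs_mult
  | |- computable_rat (fun x => - _) => apply crs_opp
  | |- computable_rat (fun x => Rmax _ _) => apply crs_Rmax
  | |- computable_rat (fun x => Rmin _ _) => apply crs_Rmin
  | |- computable_rat (fun x => INR _) => apply crs_INR; cps
  | |- computable_rat (fun x => / INR (S _)) => apply crs_inv_S; cps
  | |- computable_rat (fun x => val _) => apply crs_val; cps
  | |- computable_rat (fun x => if Rle_dec _ _ then _ else _) => apply crs_if_Rle
  | |- computable_rat (fun x => if (_ <=? _)%nat then _ else _) => apply crs_if_le; cps
  | H : computable_rat2 ?r |- computable_rat (fun x => ?r (@?g x) (@?h x)) =>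
      apply (crs_app2 r g h); [exact H | cps | cps]
  | H : computable_rat (fun y => ?r (fst y) (snd y)) |- computable_rat (fun x => ?r (@?g x) (@?h x)) =>
      apply (crs_app2 r g h); [exact H | cps | cps]
  | H : computable_rat ?r |- computable_rat (fun x => ?r (@?g x)) =>
      apply (crs_comp r g H); cpm_tac; cps
  | H : computable_rat (fun _ => ?r) |- computable_rat (fun x => ?r) =>
      apply (crs_comp _ (fun _ => 0%nat) H); apply cpm_nat, cp_const
  end; cbv beta; cbn [fst snd].
Ltac crss := repeat crs_step.

Lemma computable_rat_seq_crs (r : nat -> R) : computable_rat_seq r <-> computable_rat r.
Proof.
  split.
  - intros (a & b & d & Ha & Hb & Hd & E).
    apply (crs_ext (fun x => frac (a x) (b x) (d x))); auto using crs_frac.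
  - intros (a & b & d & Ha & Hb & Hd & E)%crs_inv; exists a, b, d; auto.
Qed.

(** * Course-of-values recursion along a chain of sequences *)

(* Rows of the recursion are stored as codes of lists. *)
Definition nth_code (t k : nat) : nat :=
  code_fst (nat_rect (fun _ => nat) t (fun _ s => code_snd s) k).

Lemma cp2_nth_code : computable2_on nth_code.
Proof. unfold computable2_on, nth_code; cps. Qed.
#[export] Hint Resolve cp2_nth_code : cpdb.

Lemma nth_code_0 a s : nth_code (code_pair a s) 0 = a.
Proof. apply code_fst_pair. Qed.

Lemma nth_code_S a s k : nth_code (code_pair a s) (S k) = nth_code s k.
Proof.
  unfold nth_code; f_equal.
  induction k as [|k IH]; cbn in *; [apply code_snd_pair | now rewrite IH].
Qed.

(** Built from the back: after m <= K rounds it lists the last m of the values h 0, ..., h (K - 1)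
    in their order. *)
Definition table (h : nat -> nat) (K m : nat) : nat :=
  nat_rect (fun _ => nat) 0%nat (fun i s => code_pair (h (K - S i)%nat) s) m.

Lemma nth_table h K m k : (k < m <= K)%nat ->
  nth_code (table h K m) k = h (K - m + k)%nat.
Proof.
  revert k; induction m as [|m IH]; intros k Hk; [lia|].
  unfold table in *; cbn [nat_rect]; destruct k.
  - rewrite nth_code_0; f_equal; lia.
  - rewrite nth_code_S, IH by lia; f_equal; lia.
Qed.

(** For a single j the recursion on u is not closed, since column j calls column [pred j]. The row
    of all columns below K is closed, so whole rows are iterated; K = S j suffices to read off
    column j. *)
Lemma crs_chain (Z : nat -> nat -> R) (G : nat -> nat -> R -> R -> R) :
  (forall u j, Z (S u) j = G u j (Z u j) (Z u (pred j))) ->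
  computable_rat (Z 0%nat) ->
  computable_rat (fun y : nat * nat * nat * nat =>
    G (fst (fst (fst y))) (snd (fst (fst y))) (val (snd (fst y))) (val (snd y))) ->
  computable_rat (fun y : nat * nat => Z (fst y) (snd y)).
Proof.
  intros HS (b & Hb & E0) (g & Hg & E).
  set (T := fun K u => nat_rect (fun _ => nat) (table b K K)
    (fun u t => table (fun j => g (u, j, nth_code t j, nth_code t (pred j))) K K) u).
  assert (HT : computable2_on T).
  { unfold computable2_on, T, table. cps. }
  exists (fun y => nth_code (T (S (snd y)) (fst y)) (snd y)); split; [cps|].
  intros [u j]; cbn [fst snd].
  assert (H : forall K, (j < K)%nat -> Z u j = val (nth_code (T K u) j)).
  { revert j; induction u as [|u IH]; intros j K Hj; unfold T; cbn [nat_rect].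
    - rewrite nth_table, Nat.sub_diag by lia; apply E0.
    - rewrite nth_table, Nat.sub_diag by lia; fold (T K u); cbn [Nat.add].
      rewrite HS, (IH j K), (IH (pred j) K) by lia.
      apply (E (u, j, _, _)). }
  apply H; lia.
Qed.

(** * Measure of dyadic cells *)

Fixpoint rsum (f : nat -> R) (k : nat) : R :=
  match k with O => 0 | S k => rsum f k + f k end.

Fixpoint nsum (f : nat -> nat) (k : nat) : nat :=
  match k with O => 0%nat | S k => (nsum f k + f k)%nat end.

Lemma rsum_le f g k : (forall i, (i < k)%nat -> f i <= g i) -> rsum f k <= rsum g k.
Proof.
  induction k as [|k IH]; intros H; cbn; [lra|].
  apply Rplus_le_compat; [apply IH; intros; apply H; lia | apply H; lia].
Qed.

Lemma rsum_minus f g k : rsum (fun i => f i - g i) k = rsum f k - rsum g k.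
Proof. induction k as [|k IH]; cbn; lra. Qed.

Lemma rsum_scal c f k : rsum (fun i => c * f i) k = c * rsum f k.
Proof. induction k as [|k IH]; cbn; lra. Qed.

Lemma rsum_ext f g k : (forall i, (i < k)%nat -> f i = g i) -> rsum f k = rsum g k.
Proof.
  intros H; apply Rle_antisym; apply rsum_le; intros i Hi; specialize (H i Hi); lra.
Qed.

Lemma rsum_telescope f k : rsum (fun i => f (S i) - f i) k = f k - f 0%nat.
Proof. induction k as [|k IH]; cbn; lra. Qed.

Lemma nsum_le f g k : (forall i, (i < k)%nat -> (f i <= g i)%nat) -> (nsum f k <= nsum g k)%nat.
Proof.
  induction k as [|k IH]; intros H; cbn; [lia|].
  apply Nat.add_le_mono; [apply IH; intros; apply H; lia | apply H; lia].
Qed.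

Lemma nsum_mono f k k' : (k <= k')%nat -> (nsum f k <= nsum f k')%nat.
Proof. induction 1; cbn; lia. Qed.

Lemma INR_nsum f k : INR (nsum f k) = rsum (fun i => INR (f i)) k.
Proof. induction k as [|k IH]; cbn [nsum rsum]; [reflexivity | rewrite plus_INR; lra]. Qed.

Lemma cp_nsum {X} {CX : ctx X} (f : X -> nat -> nat) (k : X -> nat) :
  computable (fun y : X * nat => f (fst y) (snd y)) -> computable k -> computable (fun x => nsum (f x) (k x)).
Proof.
  intros Hf Hk.
  apply (cp_ext (fun x => nat_rect (fun _ => nat) 0%nat
    (fun i s => (s + f x i)%nat) (k x))).
  - intros x; induction (k x) as [|n IH]; cbn; auto.
  - cps; apply (cp_comp (fun y : X * nat => f (fst y) (snd y))
      (fun y : X * nat * nat => (fst (fst y), snd y)) Hf); cpm_tac; cps.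
Qed.

Definition lsum {A} (f : A -> R) (l : list A) : R := fold_right (fun a s => f a + s) 0 l.

Lemma lsum_filter_le {A} (f : A -> R) (p : A -> bool) w l :
  (forall a, In a l -> 0 <= f a) -> (forall a, In a l -> p a = true -> w <= f a) ->
  INR (length (filter p l)) * w <= lsum f l.
Proof.
  induction l as [|a l IH]; intros H0 H; cbn [filter lsum fold_right length].
  - cbn; lra.
  - specialize (IH (fun b Hb => H0 b (or_intror Hb)) (fun b Hb => H b (or_intror Hb))).
    pose proof (H0 a (or_introl eq_refl)).
    specialize (H a (or_introl eq_refl)); fold (lsum f l).
    destruct (p a); [|lra].
    specialize (H eq_refl); cbn [length]; rewrite S_INR; lra.
Qed.

Lemma lsum_le {A} (f g : A -> R) l :
  (forall a, In a l -> f a <= g a) -> lsum f l <= lsum g l.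
Proof.
  induction l as [|a l IH]; intros H; cbn; [lra|].
  apply Rplus_le_compat; [apply H; now left | apply IH; intros; apply H; now right].
Qed.

Lemma lsum_minus {A} (f g : A -> R) l : lsum (fun a => f a - g a) l = lsum f l - lsum g l.
Proof. unfold lsum in *; induction l as [|a l IH]; cbn; lra. Qed.

(** The number 0.s in binary. The cell of s is the dyadic interval from [rlo s] to [rhi s]. *)
Definition rlo (s : list bool) : R :=
  fold_right (fun (b : bool) y => ((if b then 1 else 0) + y) / 2) 0 s.
Definition wid (s : list bool) : R := (/ 2) ^ length s.
Definition rhi (s : list bool) : R := rlo s + wid s.

Lemma wid_pos s : 0 < wid s.
Proof. apply pow_lt; lra. Qed.

Lemma rlo_cons (b : bool) s : rlo (b :: s) = ((if b then 1 else 0) + rlo s) / 2.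
Proof. reflexivity. Qed.

Lemma wid_cons b s : wid (b :: s) = wid s / 2.
Proof. unfold wid; cbn; lra. Qed.

Lemma wid_nil : wid [] = 1.
Proof. reflexivity. Qed.

Lemma rlo_nil : rlo [] = 0.
Proof. reflexivity. Qed.

Lemma rlo_rhi_bounds s : 0 <= rlo s /\ rhi s <= 1.
Proof.
  unfold rhi; induction s as [|b s [IH1 IH2]];
    rewrite ?rlo_nil, ?wid_nil, ?rlo_cons, ?wid_cons; [lra|].
  destruct b; lra.
Qed.

Lemma rlo_snoc s (b : bool) :
  rlo (s ++ [b]) = rlo s + (if b then 1 else 0) * wid s / 2.
Proof.
  induction s as [|a s IH]; cbn [app];
    rewrite ?rlo_cons, ?wid_cons, ?rlo_nil, ?wid_nil, ?IH; lra.
Qed.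

Lemma wid_snoc s b : wid (s ++ [b]) = wid s / 2.
Proof. unfold wid; rewrite length_app, Nat.add_comm; cbn [length Nat.add pow]; lra. Qed.

Lemma prefix_cell s t : prefixb s t = true -> rlo s <= rlo t /\ rhi t <= rhi s.
Proof.
  revert t; induction s as [|a s IH]; intros t H.
  - unfold rhi at 2; rewrite rlo_nil, wid_nil; pose proof (rlo_rhi_bounds t); lra.
  - destruct t as [|b t]; [discriminate|]; cbn in H.
    apply andb_prop in H as [E H]; apply Bool.eqb_prop in E as ->.
    specialize (IH t H); unfold rhi in *; rewrite !rlo_cons, !wid_cons; lra.
Qed.

(** Dyadic cells are nested or disjoint, and the shorter string has the larger cell. *)
Lemma nonprefix_cell s t : (length s <= length t)%nat -> prefixb s t = false ->
  rhi t <= rlo s \/ rhi s <= rlo t.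
Proof.
  revert t; induction s as [|a s IH]; intros t L H; [discriminate|].
  destruct t as [|b t]; cbn in L; [lia|]; cbn in H.
  pose proof (rlo_rhi_bounds s); pose proof (rlo_rhi_bounds t).
  destruct (Bool.eqb a b) eqn:E.
  - apply Bool.eqb_prop in E as ->.
    specialize (IH t ltac:(lia) H); unfold rhi in *; rewrite !rlo_cons, !wid_cons; lra.
  - destruct a, b; try discriminate; unfold rhi in *; rewrite !rlo_cons, !wid_cons; lra.
Qed.

Lemma all_strings_length n s : In s (all_strings n) -> length s = n.
Proof.
  revert s; induction n as [|n IH]; cbn; intros s H; [now destruct H as [<-|[]]|].
  apply in_flat_map in H as (t & Ht & H).
  destruct H as [<-|[<-|[]]]; cbn; f_equal; auto.
Qed.

Lemma lsum_flat_map2 {A} (f : A -> R) (g h : A -> A) l :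
  lsum f (flat_map (fun a => [g a; h a]) l) = lsum (fun a => f (g a) + f (h a)) l.
Proof. unfold lsum; induction l as [|a l IH]; cbn; [reflexivity | rewrite IH; lra]. Qed.

(* The cells of a fixed length tile the unit interval. *)
Lemma lsum_all_strings (m : R -> R) n :
  lsum (fun t => m (rhi t) - m (rlo t)) (all_strings n) = m 1 - m 0.
Proof.
  revert m; induction n as [|n IH]; intros m.
  - cbn; unfold rhi; rewrite rlo_nil, wid_nil, Rplus_0_l; lra.
  - cbn [all_strings]; rewrite lsum_flat_map2.
    (* Prepending a bit halves a cell and moves it to the left or right half; both images are
       absorbed into the function m. *)
    specialize (IH (fun y => m (y / 2) + m ((1 + y) / 2))); cbn beta in IH.
    replace ((1 + 1) / 2) with 1 in IH by lra.
    replace (0 / 2) with 0 in IH by lra.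
    replace ((1 + 0) / 2) with (1 / 2) in IH by lra.
    transitivity (m (1 / 2) + m 1 - (m 0 + m (1 / 2))); [rewrite <- IH | lra].
    assert (E : forall b t, rhi (b :: t) = ((if b then 1 else 0) + rhi t) / 2)
      by (intros b t; unfold rhi; rewrite rlo_cons, wid_cons; lra).
    assert (E' : forall t, rhi t / 2 = (0 + rhi t) / 2 /\ rlo t / 2 = (0 + rlo t) / 2)
      by (intros; lra).
    apply Rle_antisym; apply lsum_le; intros t _;
      rewrite !E; destruct (E' t) as [-> ->]; rewrite !rlo_cons; lra.
Qed.

(** Weighted counting: m is the distribution function of a mass that gives every cell of the union
    at least w times its width, while the total mass is at most w c. In [interval_test] the weight w
    is the multiplicity of the covering. *)
Lemma cyl_measure_le (S : list (list bool)) (w c : R) (m : R -> R) : 0 < w ->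
  (forall y y', y <= y' -> m y <= m y') ->
  (forall s t, In s S -> prefixb s t = true -> w * wid t <= m (rhi t) - m (rlo t)) ->
  m 1 - m 0 <= w * c -> cyl_measure S <= c.
Proof.
  intros Hw Hm H Hc; unfold cyl_measure.
  set (L := fold_right _ _ S); clearbody L.
  set (p := fun t => existsb (fun s => prefixb s t) S).
  apply (Rmult_le_reg_l w); [lra|]; refine (Rle_trans _ _ _ _ Hc).
  rewrite <- (lsum_all_strings m L).
  replace (w * _) with (INR (length (filter p (all_strings L))) * (w * (/ 2) ^ L)).
  - apply lsum_filter_le.
    + intros t _; pose proof (wid_pos t).
      specialize (Hm (rlo t) (rhi t) ltac:(unfold rhi; lra)); lra.
    + intros t Ht Hp; apply existsb_exists in Hp as (s & Hs & Hp).
      rewrite <- (all_strings_length L t Ht); now apply (H s).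
  - rewrite pow_inv; unfold Rdiv; ring.
Qed.

(** * Codes of strings and binary expansions *)

(** With s = [pbits p], the number p is 1s in binary, so scaling it by the width of s gives 1.s.
    Cell bounds thus become rational functions of the code. *)
Lemma pbits_cell p : INR (Pos.to_nat p) * wid (pbits p) = 1 + rlo (pbits p).
Proof.
  induction p as [p IH|p IH|]; cbn [pbits]; rewrite ?rlo_snoc, ?wid_snoc.
  - rewrite Pos2Nat.inj_xI, S_INR, mult_INR; cbn [INR]; lra.
  - rewrite Pos2Nat.inj_xO, mult_INR; cbn [INR]; lra.
  - rewrite rlo_nil, wid_nil; change (INR (Pos.to_nat 1)) with 1; lra.
Qed.

Lemma decode_str_cell c : INR (S c) * wid (decode_str c) = 1 + rlo (decode_str c).
Proof. unfold decode_str; rewrite <- pbits_cell, SuccNat2Pos.id_succ; reflexivity. Qed.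

Lemma decode_str_length c : length (decode_str c) = Nat.log2 (S c).
Proof.
  symmetry; apply Nat.log2_unique; [lia|].
  pose proof (decode_str_cell c) as E; pose proof (rlo_rhi_bounds (decode_str c)) as [H1 H2].
  pose proof (wid_pos (decode_str c)) as P; unfold rhi in H2.
  unfold wid in *; set (n := length (decode_str c)) in *.
  assert (W : INR (2 ^ n) * (/ 2) ^ n = 1).
  { rewrite pow_INR, <- Rpow_mult_distr; cbn [INR].
    replace ((1 + 1) * / 2) with 1 by lra; apply pow1. }
  split.
  - apply INR_le; nra.
  - apply INR_lt; rewrite Nat.pow_succ_r', mult_INR; change (INR 2) with 2; nra.
Qed.

Lemma crs_decode_wid {X} {CX : ctx X} (f : X -> nat) :
  computable f -> computable_rat (fun x => wid (decode_str (f x))).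
Proof.
  intros Hf; apply (crs_ext (fun x => (/ INR (S 1)) ^ Nat.log2 (S (f x)))).
  - intros x; unfold wid; now rewrite decode_str_length.
  - apply crs_pow; [crss | cps].
Qed.

Lemma crs_decode_rlo {X} {CX : ctx X} (f : X -> nat) :
  computable f -> computable_rat (fun x => rlo (decode_str (f x))).
Proof.
  intros Hf; apply (crs_ext (fun x => INR (S (f x)) * wid (decode_str (f x)) - 1)).
  - intros x; rewrite decode_str_cell; lra.
  - crss; now apply crs_decode_wid.
Qed.

Lemma decode_str_surj s : exists c, decode_str c = s.
Proof.
  assert (H : exists p, pbits p = s).
  { induction s as [|b s [p <-]] using rev_ind; [now exists xH|].
    now exists (if b then xI p else xO p); destruct b. }
  destruct H as [p <-]; exists (pred (Pos.to_nat p)).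
  unfold decode_str; f_equal; apply Pos2Nat.inj.
  rewrite SuccNat2Pos.id_succ; apply Nat.succ_pred_pos, Pos2Nat.is_pos.
Qed.

Lemma Int_part_double y :
  Int_part (2 * y) = (2 * Int_part y + (if Z.odd (Int_part (2 * y)) then 1 else 0))%Z.
Proof.
  destruct (base_Int_part y) as [H1 H2]; destruct (base_Int_part (2 * y)) as [H3 H4].
  set (j := Int_part y) in *; set (k := Int_part (2 * y)) in *.
  assert (B1 : (2 * j < k + 1)%Z) by (apply lt_IZR; rewrite plus_IZR, mult_IZR; lra).
  assert (B2 : (k < 2 * j + 2)%Z) by (apply lt_IZR; rewrite plus_IZR, mult_IZR; lra).
  pose proof (Z.div2_odd k) as E; revert E; destruct (Z.odd k); unfold Z.b2z; lia.
Qed.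

Lemma is_prefix_cell s x :
  is_prefix s (frac_bits x) -> rlo s <= frac_part x < rhi s.
Proof.
  intros H.
  assert (P : forall n, 0 < 2 ^ n) by (intros; apply pow_lt; lra).
  (* Truncating the expansion after the bits of s is taking the integer part after scaling; the
     induction appends bits at the end, where [Int_part_double] supplies the new digit. *)
  assert (E : rlo s * 2 ^ length s = IZR (Int_part (frac_part x * 2 ^ length s))).
  { induction s as [|b s IH] using rev_ind.
    - rewrite rlo_nil; cbn [length pow]; rewrite !Rmult_1_r.
      apply IZR_eq, Int_part_spec; pose proof (base_fp x); lra.
    - rewrite length_app, Nat.add_comm in *; cbn [length Nat.add] in *.
      assert (Hb : b = frac_bits x (length s)).
      { rewrite <- H by (rewrite length_app; cbn; lia); now rewrite nth_middle. }
      rewrite rlo_snoc; cbn [pow].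
      replace (frac_part x * (2 * 2 ^ length s)) with (2 * (frac_part x * 2 ^ length s)) by ring.
      rewrite Int_part_double, plus_IZR, mult_IZR, <- IH.
      + unfold frac_bits in Hb; cbn [pow] in Hb.
        replace (frac_part x * (2 * 2 ^ length s)) with (2 * (frac_part x * 2 ^ length s)) in Hb by ring.
        rewrite <- Hb; unfold wid; rewrite pow_inv.
        specialize (P (length s)); destruct b; field; lra.
      + intros i Hi; rewrite <- H by (rewrite length_app; lia); now rewrite app_nth1. }
  destruct (base_Int_part (frac_part x * 2 ^ length s)) as [H1 H2]; rewrite <- E in H1, H2.
  specialize (P (length s)); unfold rhi, wid; rewrite pow_inv.
  split; apply (Rmult_le_reg_r (2 ^ length s)) || apply (Rmult_lt_reg_r (2 ^ length s)); auto.
  rewrite Rmult_plus_distr_r, Rinv_l; lra.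
Qed.

(** * Tests made of rational intervals *)

(** [computable2] feeds [n; m] to the code, whereas the context (n, m) is encoded as [m; n]; the
    arguments have to be swapped. *)
Lemma computable2_iff (T : nat -> nat -> nat) : computable2 T <-> computable2_on T.
Proof.
  assert (S : computable2 T <-> computable (fun y : nat * nat => T (snd y) (fst y))).
  { split; intros [c H]; exists c; [intros [m n] | intros n m]; [apply H | apply (H (m, n))]. }
  rewrite S; unfold computable2_on; clear S; split; intros H.
  - apply (cp_comp _ (fun y : nat * nat => (snd y, fst y)) H), cpm_pair; cps.
    apply cpm_nat; cps.
  - apply (cp_comp _ (fun y : nat * nat => (snd y, fst y)) H), cpm_pair; cps.
    apply cpm_nat; cps.
Qed.

Lemma pow_half_small d : 0 < d -> exists n, (/ 2) ^ n < d.
Proof.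
  intros Hd; destruct (pow_lt_1_zero (/ 2) ltac:(rewrite Rabs_pos_eq; lra) d Hd) as [N H].
  exists N; specialize (H N (Nat.le_refl N)).
  now rewrite Rabs_pos_eq in H by (apply pow_le; lra).
Qed.

Lemma frac_bits_cell x n : exists c,
  is_prefix (decode_str c) (frac_bits x) /\ wid (decode_str c) = (/ 2) ^ n.
Proof.
  destruct (decode_str_surj (map (frac_bits x) (seq 0 n))) as [c E].
  exists c; rewrite E; split.
  - intros i Hi; rewrite length_map, length_seq in Hi.
    rewrite (nth_indep _ _ (frac_bits x 0%nat)) by (now rewrite length_map, length_seq).
    now rewrite map_nth, seq_nth.
  - unfold wid; now rewrite length_map, length_seq.
Qed.

Lemma Int_part_cell x s : is_prefix s (frac_bits x) ->
  IZR (Int_part x) + rlo s <= x < IZR (Int_part x) + rhi s.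
Proof.
  intros H%is_prefix_cell; unfold frac_part in H; lra.
Qed.

Lemma In_test_stage T n k s : In s (test_stage T n k) <->
  exists j c, (j < k)%nat /\ T n j = S c /\ s = decode_str c.
Proof.
  unfold test_stage; rewrite in_flat_map; split.
  - intros (j & Hj & H); apply in_seq in Hj; exists j.
    destruct (T n j) as [|c]; [destruct H|].
    destruct H as [<-|[]]; exists c; repeat split; lia.
  - intros (j & c & Hj & E & ->); exists j; rewrite E; split; [apply in_seq; lia | now left].
Qed.

Definition indicator (l r x : R) : nat :=
  if Rlt_dec l x then if Rlt_dec x r then 1%nat else 0%nat else 0%nat.

Lemma indicator_cases l r x :
  indicator l r x = 1%nat /\ l < x < r \/ indicator l r x = 0%nat /\ ~ (l < x < r).
Proof. unfold indicator; destruct (Rlt_dec l x), (Rlt_dec x r); auto; right; split; auto; lra. Qed.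

(** Finitely many open intervals around x leave room for a common neighbourhood, hence for a whole
    dyadic cell containing x. *)
Lemma indicator_margin (l r : nat -> R) x k : exists d, 0 < d /\
  forall i, (i < k)%nat -> indicator (l i) (r i) x = 1%nat -> l i + d <= x <= r i - d.
Proof.
  induction k as [|k (d & Hd & H)]; [exists 1; split; [lra | lia]|].
  destruct (Nat.eq_dec (indicator (l k) (r k) x) 1) as [E|E].
  - assert (B : l k < x < r k).
    { destruct (indicator_cases (l k) (r k) x) as [[_ B]|[B _]]; [exact B | congruence]. }
    exists (Rmin d (Rmin (x - l k) (r k - x))).
    pose proof (Rmin_l d (Rmin (x - l k) (r k - x))).
    pose proof (Rmin_r d (Rmin (x - l k) (r k - x))).
    pose proof (Rmin_l (x - l k) (r k - x)); pose proof (Rmin_r (x - l k) (r k - x)).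
    split; [repeat apply Rmin_pos; lra|].
    intros i Hi Ei; destruct (Nat.eq_dec i k) as [->|]; [lra|].
    specialize (H i ltac:(lia) Ei); lra.
  - exists d; split; auto; intros i Hi Ei.
    apply H; auto; destruct (Nat.eq_dec i k) as [->|]; [easy | lia].
Qed.

Definition inside (l r lo hi : R) : nat :=
  if Rle_dec l lo then if Rle_dec hi r then 1%nat else 0%nat else 0%nat.

(** As a function of v this is, up to a constant, the length of the part of [l, r] below v; the
    inner maximum makes it constant when r < l. *)
Definition clamp (l r v : R) : R := Rmin (Rmax v l) (Rmax l r).

Ltac minmax :=
  unfold clamp, Rmin, Rmax in *;
  repeat match goal with
  | |- context [Rle_dec ?a ?b] => destruct (Rle_dec a b)
  | H : context [Rle_dec ?a ?b] |- _ => destruct (Rle_dec a b)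
  end; try lra.

Lemma clamp_mono l r y y' : y <= y' -> clamp l r y <= clamp l r y'.
Proof. intros; minmax. Qed.

Lemma clamp_total l r y y' : clamp l r y' - clamp l r y <= Rmax 0 (r - l).
Proof. minmax. Qed.

Lemma inside_clamp l r lo hi y y' : lo <= y -> y <= y' -> y' <= hi ->
  INR (inside l r lo hi) * (y' - y) <= clamp l r y' - clamp l r y.
Proof.
  intros; unfold inside; destruct (Rle_dec l lo); [destruct (Rle_dec hi r)|];
    cbn [INR]; minmax.
Qed.

Lemma rsum_mono_fun (g : nat -> R -> R) k y y' :
  (forall i, g i y <= g i y') -> rsum (fun i => g i y) k <= rsum (fun i => g i y') k.
Proof. intros; now apply rsum_le. Qed.

(* Only cells contained in at least [m n] of the intervals of level [n] are
   enumerated; double counting bounds their total measure. *)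
Lemma interval_test x (l r : nat -> nat -> R) (m : nat -> nat) :
  computable_rat2 l -> computable_rat2 r -> computable m -> (forall n, (0 < m n)%nat) ->
  (forall n k, rsum (fun i => Rmax 0 (r n i - l n i)) k <= INR (m n) * (/ 2) ^ n) ->
  (forall n, exists k, (m n <= nsum (fun i => indicator (l n i) (r n i) x) k)%nat) ->
  ~ ML_random x.
Proof.
  intros Hl Hr Hm m_pos Hsum Hx HR; set (z := IZR (Int_part x)).
  set (ins := fun n c i =>
    inside (l n i) (r n i) (z + rlo (decode_str c)) (z + rhi (decode_str c))).
  (* Stage k, read as a pair, tests the cell coded by [code_fst k], shifted by the integer part z of
     x, against the first [code_snd k] intervals. *)
  set (T := fun n k => if (m n <=? nsum (ins n (code_fst k)) (code_snd k))%nat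
    then S (code_fst k) else 0%nat).
  apply (HR T); [split|].
  - apply computable2_iff; unfold computable2_on, T.
    apply cp_if_le; [cps | | cps | cps].
    apply (cp_nsum (fun y : nat * nat => ins (fst y) (code_fst (snd y)))); [|cps].
    unfold ins, inside, rhi.
    pose proof (fun Y CY => @crs_decode_rlo Y CY) as Hlo.
    pose proof (fun Y CY => @crs_decode_wid Y CY) as Hwid.
    repeat first [ apply cp_if_Rle | apply Hlo | apply Hwid | apply crs_IZR | crs_step | cp_step ].
  - intros n k.
    apply (cyl_measure_le _ (INR (m n)) _
      (fun v => rsum (fun i => clamp (l n i) (r n i) (z + v)) k)).
    + apply lt_0_INR, m_pos.
    + intros y y' H; apply (rsum_mono_fun (fun i v => clamp (l n i) (r n i) (z + v))).
      intros; apply clamp_mono; lra.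
    + intros s t (j & c & Hj & HT & ->)%In_test_stage Hp.
      unfold T in HT; destruct (Nat.leb_spec (m n) (nsum (ins n (code_fst j)) (code_snd j))) as [L|];
        [injection HT as <- | discriminate].
      pose proof (prefix_cell _ _ Hp) as [P1 P2].
      apply Rle_trans with (INR (nsum (ins n (code_fst j)) k) * wid t).
      * apply Rmult_le_compat_r; [apply Rlt_le, wid_pos|].
        apply le_INR; refine (Nat.le_trans _ _ _ L _); apply nsum_mono.
        (* [code_snd j] is at most j, so stage j inspects only intervals among the first k. *)
        unfold code_snd; pose proof (Nat.sqrt_le_lin j); lia.
      * rewrite INR_nsum, <- rsum_minus, Rmult_comm, <- rsum_scal.
        apply rsum_le; intros i _; rewrite Rmult_comm.
        replace (wid t) with ((z + rhi t) - (z + rlo t)) by (unfold rhi; lra).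
        apply inside_clamp; unfold rhi in *; pose proof (wid_pos t); lra.
    + rewrite <- rsum_minus; refine (Rle_trans _ _ _ _ (Hsum n k)).
      apply rsum_le; intros; apply clamp_total.
  - intros n; destruct (Hx n) as [k Hk].
    destruct (indicator_margin (l n) (r n) x k) as (d & Hd & H).
    (* A cell around x narrower than the margin d lies inside every interval counted for x. *)
    destruct (pow_half_small d Hd) as [L HL].
    destruct (frac_bits_cell x L) as (c & Hc & Hw).
    exists (code_pair c k), c; split; auto.
    pose proof (Int_part_cell _ _ Hc) as B; fold z in B.
    unfold T; rewrite code_fst_pair, code_snd_pair.
    destruct (Nat.leb_spec (m n) (nsum (ins n c) k)) as [|G]; auto; exfalso.
    apply (Nat.lt_irrefl (m n)); refine (Nat.le_lt_trans _ _ _ Hk _).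
    refine (Nat.le_lt_trans _ _ _ _ G); apply nsum_le; intros i Hi.
    specialize (H i Hi).
    destruct (indicator_cases (l n i) (r n i) x) as [[I _]|[-> _]]; [|lia].
    specialize (H I); rewrite I.
    unfold ins, inside, rhi in *.
    repeat destruct (Rle_dec _ _); first [lia | lra].
Qed.

(** If x were in infinitely many of the intervals, then for K > M the points covered at least K 2^n
    times would form the n-th level of a test that x fails: their measure is at most M / (K 2^n). *)
Lemma solovay_test x (l r : nat -> R) M :
  computable_rat l -> computable_rat r -> (forall k, rsum (fun i => Rmax 0 (r i - l i)) k <= M) ->
  ML_random x -> exists N, forall i, (N <= i)%nat -> ~ (l i < x < r i).
Proof.
  intros Hl Hr HM HR; apply NNPP; intros Hinf.
  assert (Inf : forall N, exists i, (N <= i)%nat /\ l i < x < r i).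
  { intros N; apply NNPP; intros H; apply Hinf; exists N; intros i Hi Hx.
    apply H; now exists i. }
  destruct (INR_unbounded M) as [K HK].
  assert (M0 : 0 <= M) by apply (HM 0%nat).
  apply (interval_test x (fun _ => l) (fun _ => r) (fun n => (K * 2 ^ n)%nat)); auto.
  - unfold computable2_on, computable_rat2; crss.
  - unfold computable2_on, computable_rat2; crss.
  - cps.
  - intros n; apply Nat.mul_pos_pos.
    + apply INR_lt; cbn; lra.
    + apply Nat.neq_0_lt_0, Nat.pow_nonzero; lia.
  - intros n k; specialize (HM k).
    rewrite mult_INR, pow_INR, Rmult_assoc, <- Rpow_mult_distr.
    change (INR 2) with 2; rewrite Rinv_r, pow1 by lra; lra.
  - intros n; generalize (K * 2 ^ n)%nat; intros m; induction m as [|m [k IH]].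
    + exists 0%nat; lia.
    + destruct (Inf k) as (i & Hi & H); exists (S i); cbn [nsum].
      pose proof (nsum_mono (fun i => indicator (l i) (r i) x) k i Hi).
      destruct (indicator_cases (l i) (r i) x) as [[I _]|[_ I]]; [lia | contradiction].
Qed.

Lemma geometric_rsum c k : 0 <= c < 1 -> rsum (pow c) k <= / (1 - c).
Proof.
  intros Hc.
  assert (E : rsum (pow c) k * (1 - c) = 1 - c ^ k).
  { induction k as [|k IH]; cbn [rsum pow]; [lra | rewrite Rmult_plus_distr_r, IH; ring]. }
  apply (Rmult_le_reg_r (1 - c)); [lra|]; rewrite E, Rinv_l by lra.
  pose proof (pow_le c k ltac:(lra)); lra.
Qed.

Lemma rational_not_random x : computable_rat (fun _ : nat => x) -> ~ ML_random x.
Proof.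
  intros Hx HR.
  destruct (solovay_test x (fun i => x - (/ 2) ^ i) (fun i => x + (/ 2) ^ i) 4) as [N H]; auto.
  - crss.
  - crss.
  - intros k; pose proof (geometric_rsum (/ 2) k ltac:(lra)).
    apply Rle_trans with (rsum (fun i => 2 * (/ 2) ^ i) k); [|rewrite rsum_scal; lra].
    apply rsum_le; intros i _; pose proof (pow_le (/ 2) i ltac:(lra)); minmax.
  - apply (H N); auto; pose proof (pow_lt (/ 2) N ltac:(lra)); lra.
Qed.

(** Passing to the levels j0 + j1 n, with C c^j0 <= 1 and c^j1 <= 1/2, turns the geometric bound
    into the bound 2^-n. *)
Lemma cover_test x (l r : nat -> nat -> R) C c :
  computable_rat2 l -> computable_rat2 r -> 0 <= c < 1 ->
  (forall n k, rsum (fun i => Rmax 0 (r n i - l n i)) k <= C * c ^ n) ->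
  (forall n, exists i, l n i <= x <= r n i) -> ~ ML_random x.
Proof.
  intros Hl Hr Hc Hsum Hx HR.
  assert (C0 : 0 <= C) by (specialize (Hsum 0%nat 0%nat); cbn in Hsum; lra).
  assert (small : forall d, 0 < d -> exists j, c ^ j <= d).
  { intros d Hd; destruct (pow_lt_1_zero c ltac:(rewrite Rabs_pos_eq; lra) d Hd) as [N H].
    exists N; specialize (H N (Nat.le_refl N)).
    rewrite Rabs_pos_eq in H by (apply pow_le; lra); lra. }
  destruct (small (/ (C + 1))) as [j0 H0]; [apply Rinv_0_lt_compat; lra|].
  destruct (small (/ 2)) as [j1 H1]; [lra|].
  assert (H0' : C * c ^ j0 <= 1).
  { apply Rle_trans with (C * / (C + 1)); [now apply Rmult_le_compat_l|].
    apply (Rmult_le_reg_r (C + 1)); [lra|]; rewrite Rmult_assoc, Rinv_l; lra. }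
  pose (f := fun n => (j0 + j1 * n)%nat).
  assert (Hf : computable f) by (unfold f; cps).
  apply (interval_test x (fun n => l (f n)) (fun n => r (f n)) (fun _ => 1%nat)).
  - unfold computable_rat2; apply (crs_app2 l); auto; cps.
  - unfold computable_rat2; apply (crs_app2 r); auto; cps.
  - cps.
  - intros; lia.
  - intros n k; refine (Rle_trans _ _ _ (Hsum (f n) k) _); unfold f.
    rewrite pow_add, pow_mult, <- Rmult_assoc.
    apply Rmult_le_compat; [apply Rmult_le_pos; auto; apply pow_le; lra
      | apply pow_le, pow_le; lra | exact H0' |].
    apply pow_incr; split; auto; apply pow_le; lra.
  - intros n; destruct (Hx (f n)) as [i Hi].
    (* Closed intervals are as good as open ones: a random x is not one of their rational
       endpoints. *)
    assert (Hne : l (f n) i <> x /\ r (f n) i <> x).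
    { split; intros <-; revert HR; apply rational_not_random.
      - apply (crs_app2 l (fun _ => f n) (fun _ => i)); auto; cps.
      - apply (crs_app2 r (fun _ => f n) (fun _ => i)); auto; cps. }
    exists (S i); cbn [nsum].
    destruct (indicator_cases (l (f n) i) (r (f n) i) x) as [[I _]|[_ I]]; [lia | lra].
  - exact HR.
Qed.

(** Think of E n u as the right end of the n-th cover at stage u; the part added next runs from
    max(E n u, a (S u)) to E n (S u). At the first stage where the end passes alpha, the added
    interval contains alpha, because a never exceeds alpha. For - alpha the cover is mirrored. *)
Lemma queue_test alpha (a : nat -> R) (E : nat -> nat -> R) C c :
  computable_rat a -> computable_rat2 E -> 0 <= c < 1 ->
  (forall u, a u <= alpha) -> (forall n, E n 0%nat <= alpha) ->
  (forall n k, rsum (fun u => Rmax 0 (E n (S u) - Rmax (E n u) (a (S u)))) k <= C * c ^ n) ->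
  (forall n, exists u, alpha < E n u) -> ~ (ML_random alpha \/ ML_random (- alpha)).
Proof.
  intros Ha HE Hc Hle H0 Hsum Hx.
  pose (l := fun n u => Rmax (E n u) (a (S u))); pose (r := fun n u => E n (S u)).
  assert (Hl : computable_rat2 l) by (unfold computable_rat2, l; crss).
  assert (Hr : computable_rat2 r) by (unfold computable_rat2, r; crss).
  assert (Hlr : forall n, exists u, l n u <= alpha < r n u).
  { intros n; destruct (Hx n) as [u Hu]; induction u as [|u IH].
    - specialize (H0 n); lra.
    - destruct (Rlt_le_dec alpha (E n u)) as [|L]; auto.
      exists u; specialize (Hle (S u)); unfold l, r; minmax. }
  intros [HR|HR]; revert HR.
  - apply (cover_test alpha l r C c); auto.
    intros n; destruct (Hlr n) as [u Hu]; exists u; lra.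
  - apply (cover_test (- alpha) (fun n u => - r n u) (fun n u => - l n u) C c); auto.
    + unfold computable_rat2; crss.
    + unfold computable_rat2; crss.
    + intros n k; refine (Rle_trans _ _ _ _ (Hsum n k)).
      apply rsum_le; intros u _; unfold l, r; minmax.
    + intros n; destruct (Hlr n) as [u Hu]; exists u; lra.
Qed.

Lemma cv_const c : Un_cv (fun _ => c) c.
Proof. intros eps He; exists 0%nat; intros; unfold Rdist; rewrite Rminus_diag, Rabs_R0; lra. Qed.

Lemma cv_scal c r x : Un_cv r x -> Un_cv (fun n => c * r n) (c * x).
Proof. intros; apply (CV_mult (fun _ => c)); auto using cv_const. Qed.

(** * Left-c.e. reals *)

Lemma cv_le r x c : Un_cv r x -> (exists N, forall n, (N <= n)%nat -> r n <= c) -> x <= c.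
Proof.
  intros H [N HN]; apply Rnot_lt_le; intros L.
  destruct (H (x - c) ltac:(lra)) as [N' H'].
  specialize (HN (max N N') ltac:(lia)); specialize (H' (max N N') ltac:(lia)).
  unfold Rdist in H'; apply Rabs_def2 in H'; lra.
Qed.

Lemma cv_gt r x c : Un_cv r x -> c < x -> exists N, forall n, (N <= n)%nat -> c < r n.
Proof.
  intros H L; destruct (H (x - c) ltac:(lra)) as [N HN]; exists N; intros n Hn.
  specialize (HN n Hn); unfold Rdist in HN; apply Rabs_def2 in HN; lra.
Qed.

Lemma growing_le r : (forall n, r n <= r (S n)) -> forall m n, (m <= n)%nat -> r m <= r n.
Proof. intros H m n; induction 1; [lra | eapply Rle_trans; eauto]. Qed.

Lemma growing_le_lim r x : (forall n, r n <= r (S n)) -> Un_cv r x -> forall n, r n <= x.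
Proof.
  intros H Hx n; apply Ropp_le_cancel, (cv_le (fun n => - r n)); [now apply CV_opp|].
  exists n; intros m Hm; pose proof (growing_le r H n m Hm); lra.
Qed.

Lemma left_ce_crs x : left_ce x <->
  exists r, computable_rat r /\ (forall n, r n <= r (S n)) /\ Un_cv r x.
Proof. split; intros (r & H & Hr); exists r; split; auto; now apply computable_rat_seq_crs. Qed.

Lemma left_ce_plus x y : left_ce x -> left_ce y -> left_ce (x + y).
Proof.
  rewrite !left_ce_crs; intros (r & Hr & Mr & Cr) (s & Hs & Ms & Cs).
  exists (fun n => r n + s n); repeat split; [crss | | now apply CV_plus].
  intros n; specialize (Mr n); specialize (Ms n); lra.
Qed.

Lemma left_ce_scal c x : computable_rat (fun _ : nat => c) -> 0 <= c -> left_ce x -> left_ce (c * x).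
Proof.
  intros Hc c0; rewrite !left_ce_crs; intros (r & Hr & Mr & Cr).
  exists (fun n => c * r n); repeat split; [crss | | now apply cv_scal].
  intros n; apply Rmult_le_compat_l; auto.
Qed.

Lemma right_ce_opp x : right_ce x <-> left_ce (- x).
Proof.
  split; intros (r & Hr & M & C); apply computable_rat_seq_crs in Hr;
    exists (fun n => - r n); (split; [apply computable_rat_seq_crs; crss|]); split.
  - intros n; specialize (M n); lra.
  - now apply CV_opp.
  - intros n; specialize (M n); lra.
  - rewrite <- (Ropp_involutive x); now apply CV_opp.
Qed.

Fixpoint running_max (r : nat -> R) (n : nat) : R :=
  match n with O => r 0%nat | S k => Rmax (running_max r k) (r (S k)) end.

Lemma running_max_ge r n : r n <= running_max r n.
Proof. destruct n; cbn; [lra | apply Rmax_r]. Qed.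

(** The approximation need not be monotone: as long as it stays below its limit, its running maximum
    has the same limit. *)
Lemma left_ce_below r x : computable_rat r -> Un_cv r x ->
  (exists N, forall n, (N <= n)%nat -> r n <= x) -> left_ce x.
Proof.
  intros Hr Hx [N HN]; set (s := fun n => r (N + n)%nat).
  assert (Hs : computable_rat s) by (unfold s; crss).
  assert (Us : forall n, running_max s n <= x).
  { induction n as [|n IH]; cbn; [|apply Rmax_lub; auto]; apply HN; lia. }
  apply left_ce_crs; exists (running_max s); repeat split.
  - assert (H : computable_rat (fun y : nat * nat => (fun _ => running_max s) (fst y) (snd y))).
    { apply (crs_rec (X := nat) (fun _ => running_max s) (fun _ n c => Rmax c (s (S n))));
        [reflexivity | cbn | cbn]; crss. }
    apply (crs_app2 (fun _ => running_max s) (fun n : nat => n) (fun n => n) H); cps.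
  - intros n; apply Rmax_l.
  - intros eps He; destruct (Hx eps He) as [N' H']; exists N'; intros n Hn.
    specialize (H' (N + n)%nat ltac:(lia)); unfold Rdist in *.
    specialize (Us n); pose proof (running_max_ge s n); unfold s in *.
    apply Rabs_def2 in H'; apply Rabs_def1; lra.
Qed.

(** * Kučera-Slaman *)

(* Pouring [w] times every increment of [a] onto the line, each time at the
   current point of [g]: the poured set ahead of [g u] is the interval
   up to [pour g a w u]. *)
Fixpoint pour (g a : nat -> R) (w : R) (u : nat) : R :=
  match u with
  | O => g 0%nat
  | S u => Rmax (pour g a w u) (g (S u)) + w * (a (S u) - a u)
  end.

(** What is poured from stage s on lies to the right of g s without overlap. *)
Lemma pour_ge g a w s u : (forall n, a n <= a (S n)) -> 0 <= w -> (s <= u)%nat ->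
  g s + w * (a u - a s) <= pour g a w u.
Proof.
  intros Ha Hw; induction 1 as [|u Hu IH].
  - destruct s as [|s]; cbn [pour]; [lra|].
    pose proof (Rmax_r (pour g a w s) (g (S s))); specialize (Ha s).
    assert (0 <= w * (a (S s) - a s)) by (apply Rmult_le_pos; lra); lra.
  - cbn [pour]; pose proof (Rmax_l (pour g a w u) (g (S u))); lra.
Qed.

(** Pour with weights w = 2^-(n+1). As gamma is random up to sign, the front of some cover never
    passes gamma. Then g s + w (a u - a s) <= gamma for all s <= u, so g s - w a s stays below its
    limit gamma - w alpha, which is therefore left-c.e.; multiply by 2^(n+1). *)
Lemma kucera_slaman gamma alpha :
  ML_random gamma \/ ML_random (- gamma) -> left_ce gamma -> left_ce alpha ->
  exists k, left_ce (2 ^ S k * gamma - alpha).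
Proof.
  intros HR (g & Hg & Mg & Cg)%left_ce_crs (a & Ha & Ma & Ca)%left_ce_crs.
  assert (P : forall n, 0 < (/ 2) ^ S n) by (intros; apply pow_lt; lra).
  apply NNPP; intros Hno.
  apply (queue_test gamma g (fun n => pour g a ((/ 2) ^ S n)) (alpha - a 0%nat) (/ 2)); auto.
  - unfold computable_rat2.
    apply (crs_rec (X := nat) (fun n => pour g a ((/ 2) ^ S n))
      (fun n u e => Rmax e (g (S u)) + (/ 2) ^ S n * (a (S u) - a u))); [reflexivity | |].
    + cbn [pour]; crss.
    + crss.
  - lra.
  - now apply growing_le_lim.
  - intros n; cbn [pour]; now apply growing_le_lim.
  - intros n k.
    apply Rle_trans with (rsum (fun u => (/ 2) ^ S n * (a (S u) - a u)) k).
    + apply rsum_le; intros u _; cbn [pour].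
      specialize (P n); specialize (Ma u).
      assert (0 <= (/ 2) ^ S n * (a (S u) - a u)) by (apply Rmult_le_pos; lra).
      apply Rmax_lub; lra.
    + rewrite rsum_scal, (rsum_telescope a).
      pose proof (growing_le_lim a alpha Ma Ca k).
      pose proof (growing_le_lim a alpha Ma Ca 0%nat).
      pose proof (pow_lt (/ 2) n ltac:(lra)); cbn [pow]; nra.
  - intros n; apply NNPP; intros Hle; apply Hno; exists n.
    assert (W : 2 ^ S n * (/ 2) ^ S n = 1)
      by (rewrite <- Rpow_mult_distr, Rinv_r by lra; apply pow1).
    set (w := (/ 2) ^ S n) in *.
    replace (2 ^ S n * gamma - alpha) with (2 ^ S n * (gamma - w * alpha))
      by (rewrite Rmult_minus_distr_l, <- Rmult_assoc, W; ring).
    specialize (P n); fold w in P.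
    assert (Hwc : computable_rat (fun _ : nat => w)) by (unfold w; crss).
    apply left_ce_scal; [|apply pow_le; lra|].
    { apply crs_pow; [apply crs_IZR | cps]. }
    apply (left_ce_below (fun s => g s - w * a s)).
    + crss.
    + apply CV_minus; auto; now apply cv_scal.
    + exists 0%nat; intros s _.
      enough (g s - w * a s + w * alpha <= gamma) by lra.
      apply (cv_le (fun u => g s - w * a s + w * a u)).
      * apply (CV_plus (fun _ => g s - w * a s)); [apply cv_const | now apply cv_scal].
      * exists s; intros u Hu.
        pose proof (pour_ge g a w s u Ma (Rlt_le _ _ P) Hu).
        destruct (Rle_lt_dec (pour g a w u) gamma); [lra|].
        exfalso; apply Hle; now exists u.
Qed.

(** * Random differences of left-c.e. reals are left-c.e. or right-c.e. *)

(** The intervals between consecutive values of a - b have bounded total length, as a + b is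
    monotone and bounded. A random limit is in finitely many of them, so from some stage on the
    approximation never crosses it and stays on one side. *)
Lemma random_difference alpha beta :
  left_ce alpha -> left_ce beta -> ML_random (alpha - beta) ->
  left_ce (alpha - beta) \/ right_ce (alpha - beta).
Proof.
  intros (a & Ha & Ma & Ca)%left_ce_crs (b & Hb & Mb & Cb)%left_ce_crs HR.
  set (g := fun n => a n - b n).
  assert (Hg : computable_rat g) by (unfold g; crss).
  assert (Cg : Un_cv g (alpha - beta)) by now apply CV_minus.
  destruct (solovay_test (alpha - beta) (fun n => Rmin (g n) (g (S n)))
    (fun n => Rmax (g n) (g (S n))) (alpha - a 0%nat + (beta - b 0%nat))) as [N HN]; auto.
  - crss.
  - crss.
  - intros k; apply Rle_trans with (rsum (fun n => (a (S n) + b (S n)) - (a n + b n)) k).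
    + apply rsum_le; intros n _; specialize (Ma n); specialize (Mb n); unfold g; minmax.
    + rewrite (rsum_telescope (fun n => a n + b n)).
      pose proof (growing_le_lim a alpha Ma Ca k); pose proof (growing_le_lim b beta Mb Cb k); lra.
  - assert (Hne : forall n, g n <> alpha - beta).
    { intros n E; revert HR; rewrite <- E; apply rational_not_random.
      apply (crs_comp g (fun _ => n)); auto; apply cpm_nat; cps. }
    destruct (Rtotal_order (g N) (alpha - beta)) as [L|[L|L]]; [left | now apply Hne in L | right].
    + apply (left_ce_below g); auto; exists N.
      enough (H : forall n, (N <= n)%nat -> g n < alpha - beta) by (intros; now apply Rlt_le, H).
      induction 1 as [|n Hn IH]; auto.
      specialize (HN n Hn); specialize (Hne (S n)); minmax.
    + apply right_ce_opp, (left_ce_below (fun n => - g n)); [crss | now apply CV_opp |]; exists N.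
      enough (H : forall n, (N <= n)%nat -> alpha - beta < g n)
        by (intros n Hn; specialize (H n Hn); lra).
      induction 1 as [|n Hn IH]; auto.
      specialize (HN n Hn); specialize (Hne (S n)); minmax.
Qed.

(** Bounds from both sides locate x within 2^-n, which gives a cover of size proportional to
    2^-n. *)
Lemma computable_not_random x : left_ce x -> right_ce x -> ~ ML_random x.
Proof.
  intros (a & Ha & Ma & Ca)%left_ce_crs (b & Hb & Mb & Cb)%right_ce_opp%left_ce_crs HR.
  assert (Hp : computable_rat (pow (/ 2))) by (change (computable_rat (fun n => (/ 2) ^ n)); crss).
  pose proof (growing_le_lim _ _ Ma Ca) as La; pose proof (growing_le_lim _ _ Mb Cb) as Lb.
  set (h := pow (/ 2)) in *.
  assert (P : forall n, 0 < h n) by (intros; apply pow_lt; lra).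
  (* Once the gap is at most h n, the end jumps to - b u + h n, strictly beyond x; the jump adds at
     most 2 h n, and later ends only decrease. At stage 0 the end is a 0, since [queue_test] wants
     it to start below x. *)
  pose (E := fun n u => if (u <=? 0)%nat then a u
    else if Rle_dec (- b u - a u) (h n) then - b u + h n else a u).
  apply (queue_test x a E 2 (/ 2)); auto.
  - unfold computable_rat2, E; crss.
  - lra.
  - intros; apply La.
  - intros n k; change ((/ 2) ^ n) with (h n).
    apply Rle_trans with (if (k <=? 0)%nat then 0
      else if Rle_dec (- b k - a k) (h n) then 2 * h n else 0).
    + specialize (P n); induction k as [|k IH]; cbn [rsum]; [cbn; lra|].
      specialize (Ma k); specialize (Mb k); unfold E in *.
      destruct k as [|k]; cbn [Nat.leb] in *; minmax.
    + specialize (P n); destruct (k <=? 0)%nat; [lra|]; destruct (Rle_dec _ _); lra.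
  - intros n.
    destruct (cv_gt (fun u => a u + b u) (x + - x) (- h n)) as [N HN].
    + now apply CV_plus.
    + specialize (P n); lra.
    + exists (S N); unfold E; cbn [Nat.leb].
      specialize (HN (S N) ltac:(lia)); specialize (Lb (S N)); specialize (P n).
      destruct (Rle_dec _ _); lra.
Qed.

(** * The ratio of the speeds of approximation cannot oscillate *)

Section Cascade.
Context (x : nat -> nat -> R) (X w : nat -> R) (M : R).
Context (x_grows : forall j u, x j u <= x j (S u)).
Context (x_lim : forall j, Un_cv (x j) (X j)).
Context (w_pos : forall j, 0 < w j).
Context (M_pos : 0 <= M).

(* [tank u j] is the measure still covered ahead of [x j u] by the [j]-th cover:
   it drains as [x j] advances, and what drains is poured, with factor [w j],
   into the cover of the next sequence. *)
Fixpoint tank (u j : nat) : R :=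
  match u with
  | O => if (j <=? 0)%nat then M else 0
  | S u => tank u j - Rmin (x j (S u) - x j u) (tank u j)
      + if (j <=? 0)%nat then 0
        else w (pred j) * Rmin (x (pred j) (S u) - x (pred j) u) (tank u (pred j))
  end.

Definition outflow j u := Rmin (x j (S u) - x j u) (tank u j).
Definition inflow j u := if (j <=? 0)%nat then 0 else w (pred j) * outflow (pred j) u.
Definition front j u := x j u + tank u j.

Lemma tank_S u j : tank (S u) j = tank u j - outflow j u + inflow j u.
Proof. reflexivity. Qed.

Lemma tank_nonneg u j : 0 <= tank u j.
Proof.
  revert j; induction u as [|u IH]; intros j.
  - cbn; destruct (j <=? 0)%nat; lra.
  - rewrite tank_S; unfold inflow, outflow.
    pose proof (Rmin_r (x j (S u) - x j u) (tank u j)).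
    destruct (j <=? 0)%nat; [lra|].
    enough (0 <= w (pred j) * Rmin (x (pred j) (S u) - x (pred j) u) (tank u (pred j))) by lra.
    apply Rmult_le_pos; [apply Rlt_le, w_pos|].
    apply Rmin_glb; auto; pose proof (x_grows (pred j) u); lra.
Qed.

Lemma inflow_nonneg j u : 0 <= inflow j u.
Proof.
  unfold inflow, outflow; destruct (j <=? 0)%nat; [lra|].
  apply Rmult_le_pos; [apply Rlt_le, w_pos|].
  apply Rmin_glb; [pose proof (x_grows (pred j) u); lra | apply tank_nonneg].
Qed.

(** The recursion of [pour], with [inflow] as the amount poured: the form that [queue_test]
    needs. *)
Lemma front_S j u : front j (S u) = Rmax (front j u) (x j (S u)) + inflow j u.
Proof. unfold front; rewrite tank_S; unfold outflow; minmax. Qed.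

Lemma front_mono j u u' : (u <= u')%nat -> front j u <= front j u'.
Proof.
  apply (growing_le (front j)); intros v; rewrite front_S.
  pose proof (Rmax_l (front j v) (x j (S v))); pose proof (inflow_nonneg j v); lra.
Qed.

Fixpoint capacity (j : nat) : R :=
  match j with O => M | S j => w j * capacity j end.

(** Conservation of measure: what leaves a tank was there at the start or came in. So the next cover
    receives at most w j times what passes through cover j. *)
Lemma inflow_le_capacity j k : rsum (inflow j) k <= capacity j.
Proof.
  assert (conservation : forall j,
    rsum (outflow j) k = rsum (inflow j) k + tank 0 j - tank k j).
  { clear j; intros j; induction k as [|k IH]; cbn [rsum]; [lra|].
    rewrite tank_S, IH; lra. }
  enough (H : rsum (inflow j) k + tank 0 j <= capacity j)
    by (pose proof (tank_nonneg 0 j); lra).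
  induction j as [|j IH].
  - cbn [capacity tank Nat.leb]; unfold inflow; cbn [Nat.leb].
    rewrite (rsum_ext _ (fun i => 0 * 0)), (rsum_scal 0 (fun _ => 0)) by (intros; lra); lra.
  - cbn [capacity tank Nat.leb]; rewrite Rplus_0_r.
    rewrite (rsum_ext _ (fun u => w j * outflow j u)) by reflexivity.
    rewrite rsum_scal; apply Rmult_le_compat_l; [apply Rlt_le, w_pos|].
    rewrite conservation; pose proof (tank_nonneg k j); lra.
Qed.

(** Once cover j reaches beyond X j, its tank never runs dry, so every later increment of x j is
    poured in full. At a stage s given by the hypothesis, the amount still to be poured exceeds the
    distance left to X (S j). *)
Lemma front_passes :
  X 0%nat < x 0%nat 0%nat + M ->
  (forall j N, exists s, (N <= s)%nat /\ X (S j) - x (S j) s < w j * (X j - x j s)) ->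
  forall j, exists u, X j < front j u.
Proof.
  intros H0 Hs j; induction j as [|j [u0 IH]].
  - exists 0%nat; exact H0.
  - destruct (Hs j u0) as (s & Hu & L).
    assert (full : forall u, (u0 <= u)%nat -> inflow (S j) u = w j * (x j (S u) - x j u)).
    { intros u Hu'; unfold inflow, outflow; cbn [Nat.leb pred]; f_equal.
      apply Rmin_left; pose proof (front_mono j u0 u Hu').
      pose proof (growing_le_lim _ _ (x_grows j) (x_lim j) (S u)); unfold front in *; lra. }
    assert (B : forall u, (s <= u)%nat ->
      x (S j) s + w j * (x j u - x j s) <= front (S j) u).
    { induction 1 as [|u Hu' IH'].
      - unfold front; pose proof (tank_nonneg s (S j)); lra.
      - rewrite front_S, full by lia.
        pose proof (Rmax_l (front (S j) u) (x (S j) (S u))); lra. }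
    destruct (cv_gt (fun u => w j * x j u) (w j * X j) (X (S j) - x (S j) s + w j * x j s))
      as [N HN]; [now apply cv_scal | lra|].
    exists (N + s)%nat; specialize (B (N + s)%nat ltac:(lia)); specialize (HN (N + s)%nat ltac:(lia)).
    lra.
Qed.

Lemma crs_tank : computable_rat2 x -> computable_rat w -> computable_rat (fun _ : nat => M) ->
  computable_rat (fun y : nat * nat => tank (fst y) (snd y)).
Proof.
  intros Hx Hw HM.
  apply (crs_chain tank (fun u j c c' => c - Rmin (x j (S u) - x j u) c
    + if (j <=? 0)%nat then 0 else w (pred j) * Rmin (x (pred j) (S u) - x (pred j) u) c'));
    [reflexivity | cbn [tank]; crss | crss].
Qed.

End Cascade.

Definition parity (n : nat) : nat := nat_rect (fun _ => nat) 0%nat (fun _ r => (1 - r)%nat) n.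

Lemma parity_cases n : parity (2 * n) = 0%nat /\ parity (S (2 * n)) = 1%nat.
Proof.
  induction n as [|n [IH1 IH2]]; [now cbn|].
  replace (2 * S n)%nat with (S (S (2 * n))) by lia.
  unfold parity in *; cbn [nat_rect] in *; rewrite IH1; now cbn.
Qed.

(** The cascade alternates: a is poured onto b with factor q, b onto a with factor 1/p. The two
    hypotheses make each front pass its limit, while the capacity of level 2n is M (q/p)^n. *)
Lemma no_oscillation alpha (a b : nat -> R) beta p q :
  ML_random alpha -> computable_rat a -> computable_rat b ->
  (forall n, a n <= a (S n)) -> (forall n, b n <= b (S n)) ->
  Un_cv a alpha -> Un_cv b beta ->
  computable_rat (fun _ : nat => / p) -> computable_rat (fun _ : nat => q) -> 0 < q < p ->
  (forall N, exists s, (N <= s)%nat /\ beta - b s < q * (alpha - a s)) ->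
  (forall N, exists s, (N <= s)%nat /\ p * (alpha - a s) < beta - b s) -> False.
Proof.
  intros HR Ha Hb Ma Mb Ca Cb Hp Hq Hqp Hlo Hhi.
  apply or_introl with (B := ML_random (- alpha)) in HR; revert HR.
  assert (Pp : 0 < / p) by (apply Rinv_0_lt_compat; lra).
  destruct (INR_unbounded (alpha - a 0%nat)) as [M HM].
  set (x := fun j u => if (parity j <=? 0)%nat then a u else b u).
  set (X := fun j => if (parity j <=? 0)%nat then alpha else beta).
  set (w := fun j => if (parity j <=? 0)%nat then q else / p).
  assert (cp_parity : computable parity) by (unfold parity; cps).
  assert (Hx : computable_rat2 x) by (unfold computable_rat2, x; crss).
  assert (Hw : computable_rat w) by (unfold w; crss).
  assert (x_grows : forall j u, x j u <= x j (S u))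
    by (intros; unfold x; destruct (parity j <=? 0)%nat; auto).
  assert (x_lim : forall j, Un_cv (x j) (X j))
    by (intros; unfold x, X; destruct (parity j <=? 0)%nat; auto).
  assert (w_pos : forall j, 0 < w j)
    by (intros; unfold w; destruct (parity j <=? 0)%nat; lra).
  pose proof (pos_INR M) as M_pos.
  assert (Htank : computable_rat (fun y => tank x w (INR M) (fst y) (snd y)))
    by (apply crs_tank; auto; crss).
  assert (cap : forall n, capacity w (INR M) (2 * n) = INR M * (q * / p) ^ n).
  { induction n as [|n IH]; [cbn; lra|].
    replace (2 * S n)%nat with (S (S (2 * n))) by lia; cbn [capacity].
    destruct (parity_cases n) as [E1 E2]; rewrite IH; unfold w; rewrite E1, E2; cbn; ring. }
  assert (even : forall n, x (2 * n)%nat = a /\ X (2 * n)%nat = alpha).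
  { intros n; unfold x, X; destruct (parity_cases n) as [-> _]; auto. }
  assert (c01 : 0 <= q * / p < 1).
  { split; [apply Rmult_le_pos; lra|].
    apply (Rmult_lt_reg_r p); [lra|]; rewrite Rmult_assoc, Rinv_l; lra. }
  (* Levels start at 2, not 0: the tank of level 0 is filled from the outset, so its front starts
     beyond alpha. *)
  apply (queue_test alpha a (fun n => front x w (INR M) (2 * S n)) (INR M * (q * / p)) (q * / p)); auto.
  - unfold computable_rat2, front; crss.
  - now apply growing_le_lim.
  - intros n; unfold front; destruct (even (S n)) as [-> _].
    replace (2 * S n)%nat with (S (S (2 * n))) by lia; cbn.
    rewrite Rplus_0_r; now apply growing_le_lim.
  - intros n k; rewrite Rmult_assoc; change (q * / p * (q * / p) ^ n) with ((q * / p) ^ S n).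
    rewrite <- cap; refine (Rle_trans _ _ _ _ (inflow_le_capacity x w (INR M) _ _ _ (2 * S n) k)); auto.
    apply rsum_le; intros u _; rewrite front_S; destruct (even (S n)) as [-> _].
    pose proof (inflow_nonneg x w (INR M) x_grows w_pos M_pos (2 * S n) u).
    apply Rmax_lub; lra.
  - intros n; destruct (front_passes x X w (INR M) x_grows x_lim w_pos M_pos) with (j := (2 * S n)%nat)
      as [u Hu].
    + unfold X, x; cbn; lra.
    + intros j N; destruct (Nat.Even_or_Odd j) as [[i ->]|[i ->]].
      * destruct (Hlo N) as (s & Hs & L); exists s; split; auto.
        destruct (parity_cases i) as [E1 E2]; unfold X, x, w; rewrite E1, E2; cbn; lra.
      * destruct (Hhi N) as (s & Hs & L); exists s; split; auto.
        rewrite Nat.add_1_r; replace (S (S (2 * i))) with (2 * S i)%nat by lia.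
        destruct (parity_cases i) as [_ E2], (parity_cases (S i)) as [E1 _].
        unfold X, x, w; rewrite E1, E2; cbn.
        apply (Rmult_lt_reg_l p); [lra|]; rewrite <- Rmult_assoc, Rinv_r; lra.
    + exists u; destruct (even (S n)) as [_ E]; now rewrite E in Hu.
Qed.

(** * Adding a left-c.e. real preserves randomness *)

Lemma lsum_filter {A} (f : A -> R) (p : A -> bool) l :
  lsum f (filter p l) = lsum (fun a => if p a then f a else 0) l.
Proof.
  unfold lsum; induction l as [|a l IH]; cbn; auto.
  destruct (p a); cbn; rewrite IH; lra.
Qed.

Lemma lsum_const {A} (f : A -> R) (v : R) l :
  (forall a, In a l -> f a = v) -> lsum f l = INR (length l) * v.
Proof.
  unfold lsum; induction l as [|a l IH]; intros H; cbn [fold_right length]; [cbn; lra|].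
  rewrite S_INR, (IH (fun b Hb => H b (or_intror Hb))), (H a (or_introl eq_refl)); lra.
Qed.

(* [m y] is the measure of the part of the union of the cells lying below [y]. *)
Lemma cyl_measure_distribution (S : list (list bool)) : exists m : R -> R,
  (forall y y', y <= y' -> m y <= m y') /\
  (forall y y', m y' - m y <= cyl_measure S) /\
  (forall s y y', In s S -> rlo s <= y -> y <= y' -> y' <= rhi s -> y' - y <= m y' - m y).
Proof.
  set (L := fold_right (fun s n => Nat.max (length s) n) 0%nat S).
  set (p := fun t => existsb (fun s => prefixb s t) S).
  exists (fun y => lsum (fun t => clamp (rlo t) (rhi t) y) (filter p (all_strings L))).
  repeat split.
  - intros y y' H; apply lsum_le; intros; now apply clamp_mono.
  - intros y y'; rewrite <- lsum_minus; unfold cyl_measure; fold L; fold p.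
    unfold Rdiv; rewrite <- pow_inv, <- (lsum_const wid).
    + apply lsum_le; intros t _; refine (Rle_trans _ _ _ (clamp_total _ _ _ _) _).
      unfold rhi; pose proof (wid_pos t); apply Rmax_lub; lra.
    + intros t [Ht _]%filter_In; unfold wid; now rewrite (all_strings_length L t Ht).
  - intros s y y' Hs Hy Hyy Hy'.
    pose proof (rlo_rhi_bounds s) as B.
    rewrite <- lsum_minus, lsum_filter.
    (* The tiling spreads the length of [y, y'] over the cells of length L; a cell outside the union
       misses the cell of s and contributes nothing. *)
    replace (y' - y) with (clamp y y' 1 - clamp y y' 0) by minmax.
    rewrite <- lsum_all_strings with (n := L).
    apply lsum_le; intros t Ht; pose proof (wid_pos t).
    destruct (p t) eqn:Hp.
    + unfold rhi; minmax.
    + assert (Hl : (length s <= length t)%nat).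
      { rewrite (all_strings_length L t Ht); unfold L; clear - Hs.
        induction S as [|s' S IH]; [destruct Hs|].
        destruct Hs as [->|Hs]; cbn; [lia | specialize (IH Hs); lia]. }
      assert (Hf : prefixb s t = false).
      { apply not_true_is_false; intros Ht'; apply not_true_iff_false in Hp; apply Hp.
        apply existsb_exists; now exists s. }
      destruct (nonprefix_cell s t Hl Hf); unfold rhi in *; minmax.
Qed.

Lemma crs_const_inv c : computable_rat (fun _ : nat => c) -> 0 < c -> computable_rat (fun _ : nat => / c).
Proof.
  intros (a & b & d & _ & _ & _ & E)%crs_inv Hc; specialize (E 0%nat); cbn beta in E.
  set (a0 := a 0%nat) in *; set (b0 := b 0%nat) in *; set (d0 := d 0%nat) in *.
  pose proof (INR_S_pos d0) as P.
  assert (L : (b0 < a0)%nat).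
  { apply INR_lt, Rnot_le_lt; intros L; revert Hc; apply Rle_not_lt; rewrite E; unfold frac.
    apply (Rmult_le_reg_r (INR (S d0))); [lra|].
    unfold Rdiv; rewrite Rmult_assoc, Rinv_l; lra. }
  apply (crs_ext (fun _ : nat => INR (S d0) * / INR (S (a0 - b0 - 1)))).
  - intros _; replace (S (a0 - b0 - 1)) with (a0 - b0)%nat by lia.
    apply lt_INR in L as L'; rewrite E; unfold frac; rewrite minus_INR by lia.
    field; lra.
  - apply crs_mult; [apply crs_INR; cps | apply crs_inv_S; cps].
Qed.

(** How far the cells enumerated so far reach from v; the default v stands for no progress. *)
Fixpoint cell_end (T : nat -> nat) (lo hi : nat -> R) (v : R) (k : nat) : R :=
  match k with
  | O => v
  | S k => Rmax (cell_end T lo hi v k)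
      (if (T k <=? 0)%nat then v
       else if Rle_dec (lo (pred (T k))) v
       then if Rle_dec v (hi (pred (T k))) then hi (pred (T k)) else v else v)
  end.

Lemma cell_end_spec T lo hi v k : cell_end T lo hi v k = v \/
  exists j c, (j < k)%nat /\ T j = S c /\ lo c <= v <= hi c /\ cell_end T lo hi v k = hi c.
Proof.
  induction k as [|k IH]; cbn [cell_end]; [now left|].
  apply Rmax_case.
  - destruct IH as [IH|(j & c & Hj & H)]; [now left | right; exists j, c; split; auto].
  - destruct (T k) as [|c] eqn:E; [now left|]; cbn [Nat.leb pred].
    destruct (Rle_dec _ _); [|now left]; destruct (Rle_dec _ _); [|now left].
    right; exists k, c; auto.
Qed.

Lemma cell_end_ge_hi T lo hi v k j c : (j < k)%nat -> T j = S c -> lo c <= v <= hi c ->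
  hi c <= cell_end T lo hi v k.
Proof.
  intros Hj HT Hv; induction k as [|k IH]; [lia|]; cbn [cell_end].
  destruct (Nat.eq_dec j k) as [->|].
  - rewrite HT; cbn [Nat.leb pred]; refine (Rle_trans _ _ _ _ (Rmax_r _ _)).
    destruct (Rle_dec _ _); [destruct (Rle_dec _ _)|]; lra.
  - refine (Rle_trans _ _ _ (IH _) (Rmax_l _ _)); lia.
Qed.

(* While the approximation [x u] of [x] sits in a cell ending at [e], the
   approximation [a u] of [alpha] can only grow by [(e - x u) / c]. *)
Fixpoint pulled_back (a x : nat -> R) (e : nat -> R) (c : R) (u : nat) : R :=
  match u with
  | O => a 0%nat
  | S u => Rmax (pulled_back a x e c u) (a (S u) + (e (S u) - x (S u)) * / c)
  end.

(* In the application [m y] is the measure of the part of the test below [y]. *)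
Lemma cover_pull_back alpha x c (T : nat -> nat -> nat) (lo hi : nat -> R) :
  ML_random alpha -> left_ce alpha -> left_ce (x - c * alpha) ->
  computable_rat (fun _ : nat => c) -> 0 < c -> computable2_on T -> computable_rat lo -> computable_rat hi ->
  (forall n K, exists m : R -> R,
    (forall y y', y <= y' -> m y <= m y') /\
    (forall y y', m y' - m y <= (/ 2) ^ n) /\
    (forall j k y y', (j < K)%nat -> T n j = S k ->
       lo k <= y -> y <= y' -> y' <= hi k -> y' - y <= m y' - m y)) ->
  (forall n, exists j k, T n j = S k /\ lo k < x < hi k) -> False.
Proof.
  intros HR (a & Ha & Ma & Ca)%left_ce_crs (d & Hd & Md & Cd)%left_ce_crs Hc c_pos HT Hlo Hhi Hm Hx.
  pose proof (crs_const_inv c Hc c_pos) as Hci.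
  assert (Pc : 0 < / c) by now apply Rinv_0_lt_compat.
  assert (Ec : forall r, c * (r * / c) = r) by (intros; field; lra).
  (* An approximation of x that moves at least c times as fast as a. *)
  set (xs := fun u => c * a u + d u).
  assert (Hxs : computable_rat xs) by (unfold xs; crss).
  assert (Cxs : Un_cv xs x).
  { replace x with (c * alpha + (x - c * alpha)) by ring.
    apply (CV_plus (fun u => c * a u)); auto; now apply cv_scal. }
  assert (Dxs : forall u, c * (a (S u) - a u) <= xs (S u) - xs u)
    by (intros u; unfold xs; specialize (Md u); lra).
  assert (Mxs : forall u, xs u <= xs (S u)).
  { intros u; specialize (Dxs u); specialize (Ma u).
    assert (0 <= c * (a (S u) - a u)) by (apply Rmult_le_pos; lra); lra. }
  pose proof (growing_le_lim _ _ Ma Ca) as La; pose proof (growing_le_lim _ _ Md Cd) as Ld.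
  pose proof (growing_le_lim _ _ Mxs Cxs) as Lxs.
  pose (e := fun n u => cell_end (T n) lo hi (xs u) u).
  assert (He : computable_rat2 e).
  { assert (H : computable_rat (fun y : nat * nat * nat =>
      cell_end (T (fst (fst y))) lo hi (xs (snd (fst y))) (snd y))).
    { apply (crs_rec (fun z : nat * nat => cell_end (T (fst z)) lo hi (xs (snd z)))
        (fun z k r => Rmax r (if (T (fst z) k <=? 0)%nat then xs (snd z)
           else if Rle_dec (lo (pred (T (fst z) k))) (xs (snd z))
           then if Rle_dec (xs (snd z)) (hi (pred (T (fst z) k)))
             then hi (pred (T (fst z) k)) else xs (snd z) else xs (snd z)))).
      - reflexivity.
      - cbn [cell_end]; crss.
      - crss. }
    apply (crs_comp _ (fun y : nat * nat => (fst y, snd y, snd y)) H); cpm_tac; cps. }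
  pose (E := fun n => pulled_back a xs (e n) c).
  assert (HE : computable_rat2 E).
  { unfold computable_rat2, E.
    apply (crs_rec (X := nat) (fun n => pulled_back a xs (e n) c)
      (fun n u r => Rmax r (a (S u) + (e n (S u) - xs (S u)) * / c))); [reflexivity | |].
    - cbn [pulled_back]; crss.
    - crss. }
  apply or_introl with (B := ML_random (- alpha)) in HR.
  revert HR; apply (queue_test alpha a E (/ c) (/ 2)); auto.
  - lra.
  - intros n; apply La.
  - intros n k; destruct (Hm n (S k)) as (m & m_mono & m_total & m_cell).
    (* Y u is the image of the front E n u on the line of x. Growth of the front, scaled by c, is
       charged to the part of the test between Y u and Y (S u). *)
    pose (Y := fun u => xs u + c * (E n u - a u)).
    apply Rle_trans with (rsum (fun u => / c * (m (Y (S u)) - m (Y u))) k).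
    + apply rsum_le; intros u Hu; apply (Rmult_le_reg_l c); auto.
      rewrite <- Rmult_assoc, Rinv_r, Rmult_1_l by lra.
      set (f := e n (S u)).
      assert (EE : E n (S u) = Rmax (E n u) (a (S u) + (f - xs (S u)) * / c)) by reflexivity.
      assert (Y0 : Y u <= xs (S u) + c * (E n u - a (S u)))
        by (unfold Y; specialize (Dxs u); lra).
      assert (Y1 : Y (S u) = Rmax (xs (S u) + c * (E n u - a (S u))) f).
      { unfold Y; rewrite EE; unfold Rmax.
        specialize (Ec (f - xs (S u))).
        destruct (Rle_dec (E n u) _) as [L|L]; destruct (Rle_dec (xs (S u) + _) f) as [L'|L'].
        - lra.
        - exfalso; apply L'; apply (Rmult_le_compat_l c) in L; lra.
        - apply Rnot_le_lt, (Rmult_lt_compat_l c) in L; lra.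
        - lra. }
      (* If f > v, the new piece [v, f] lies in the single cell that contains xs (S u) and ends at
         f. *)
      set (v := Rmax (xs (S u)) (xs (S u) + c * (E n u - a (S u)))).
      assert (Hv : c * Rmax 0 (E n (S u) - Rmax (E n u) (a (S u))) = Rmax 0 (f - v)).
      { rewrite <- RmaxRmult, Rmult_0_r, Rmult_minus_distr_l, EE, <- !RmaxRmult by lra.
        rewrite Rmult_plus_distr_l, Ec; unfold v; minmax. }
      rewrite Hv; apply Rmax_lub.
      * enough (m (Y u) <= m (Y (S u))) by lra.
        apply m_mono; rewrite Y1; refine (Rle_trans _ _ _ Y0 (Rmax_l _ _)).
      * destruct (Rle_lt_dec f v) as [L|L].
        { enough (m (Y u) <= m (Y (S u))) by lra.
          apply m_mono; rewrite Y1; refine (Rle_trans _ _ _ Y0 (Rmax_l _ _)). }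
        pose proof (Rmax_l (xs (S u)) (xs (S u) + c * (E n u - a (S u)))) as V1.
        pose proof (Rmax_r (xs (S u)) (xs (S u) + c * (E n u - a (S u)))) as V2.
        fold v in V1, V2; rewrite Rmax_right in Y1 by lra.
        destruct (cell_end_spec (T n) lo hi (xs (S u)) (S u)) as [Ef|(j & i & Hj & HTj & B & Ef)];
          fold (e n (S u)) in Ef; fold f in Ef; [lra|].
        specialize (m_cell j i v f ltac:(lia) HTj ltac:(lra) ltac:(lra) ltac:(lra)).
        specialize (m_mono (Y u) v ltac:(lra)); rewrite Y1; lra.
    + rewrite rsum_scal, (rsum_telescope (fun u => m (Y u))).
      apply Rmult_le_compat_l; [lra | apply m_total].
  - intros n; destruct (Hx n) as (j & i & HTj & Hi).
    destruct (cv_gt xs x (lo i) Cxs) as [N HN]; [lra|].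
    exists (S (N + j)); set (u := (N + j)%nat).
    specialize (HN (S u) ltac:(lia)); specialize (Lxs (S u)).
    pose proof (cell_end_ge_hi (T n) lo hi (xs (S u)) (S u) j i ltac:(lia) HTj ltac:(lra)) as B.
    fold (e n (S u)) in B.
    (* Since d only grows, c (alpha - a) <= x - xs at this stage, and x is below the end of its
       cell. *)
    apply Rlt_le_trans with (a (S u) + (e n (S u) - xs (S u)) * / c); [|apply Rmax_r].
    apply (Rmult_lt_reg_l c); auto; rewrite Rmult_plus_distr_l, Ec.
    specialize (Ld (S u)); unfold xs in *; lra.
Qed.

(** A test failed by x, pulled back along the approximation of x, would cover alpha. The mirrored
    claim for - x serves the case D > 1, where beta - alpha is the real of this form. *)
Lemma random_plus alpha x c :
  ML_random alpha -> left_ce alpha -> left_ce (x - c * alpha) ->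
  computable_rat (fun _ : nat => c) -> 0 < c -> ML_random x /\ ML_random (- x).
Proof.
  intros HR Ha Hx Hc c_pos.
  (* A rational x would make - alpha left-c.e., hence alpha computable. *)
  assert (irrational : ~ computable_rat (fun _ : nat => x)).
  { intros Hq; apply (computable_not_random alpha Ha); auto; apply right_ce_opp.
    replace (- alpha) with (/ c * (x - c * alpha + - x)) by (field; lra).
    apply left_ce_scal; [now apply crs_const_inv | apply Rlt_le; now apply Rinv_0_lt_compat |].
    apply left_ce_plus; auto; apply left_ce_crs; exists (fun _ => - x).
    repeat split; [crss | intros; lra | apply cv_const]. }
  (* Cells are half-open but [cover_pull_back] asks for x strictly inside; the negated endpoints
     belong to the mirrored cells. *)
  assert (edge : forall c' z, x <> IZR z + rlo (decode_str c') /\ x <> IZR z + rhi (decode_str c') /\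
    x <> - (IZR z + rlo (decode_str c')) /\ x <> - (IZR z + rhi (decode_str c'))).
  { intros c' z.
    assert (H1 : computable_rat (fun _ : nat => rlo (decode_str c'))) by (apply crs_decode_rlo; cps).
    assert (H2 : computable_rat (fun _ : nat => rhi (decode_str c'))).
    { unfold rhi; apply crs_plus; auto; apply crs_decode_wid; cps. }
    repeat split; intros E; apply irrational; rewrite E;
      first [apply crs_opp | idtac]; apply crs_plus; auto; apply crs_IZR. }
  assert (Hlo : computable_rat (fun c' => rlo (decode_str c'))) by (apply crs_decode_rlo; cps).
  assert (Hhi : computable_rat (fun c' => rhi (decode_str c'))).
  { unfold rhi; apply crs_plus; auto; apply crs_decode_wid; cps. }
  split; intros T [HT HM] Hf; apply computable2_iff in HT.
  - set (z := Int_part x).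
    apply (cover_pull_back alpha x c T (fun i => IZR z + rlo (decode_str i))
      (fun i => IZR z + rhi (decode_str i))); auto; [crss | crss | |].
    + intros n K.
      destruct (cyl_measure_distribution (test_stage T n K)) as (m & M1 & M2 & M3).
      exists (fun y => m (y - IZR z)); repeat split.
      * intros y y' H; apply M1; lra.
      * intros y y'; refine (Rle_trans _ _ _ (M2 _ _) (HM n K)).
      * intros j i y y' Hj Hi H1 H2 H3.
        replace (y' - y) with (y' - IZR z - (y - IZR z)) by ring.
        apply (M3 (decode_str i)); try lra; apply In_test_stage; now exists j, i.
    + intros n; destruct (Hf n) as (j & i & HTj & Hp); exists j, i; split; auto.
      apply Int_part_cell in Hp; fold z in Hp.
      destruct (edge i z) as (? & ? & _); lra.
  - set (z := Int_part (- x)).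
    apply (cover_pull_back alpha x c T (fun i => - (IZR z + rhi (decode_str i)))
      (fun i => - (IZR z + rlo (decode_str i)))); auto; [crss | crss | |].
    + intros n K.
      destruct (cyl_measure_distribution (test_stage T n K)) as (m & M1 & M2 & M3).
      exists (fun y => - m (- y - IZR z)); repeat split.
      * intros y y' H; apply Ropp_le_contravar, M1; lra.
      * intros y y'; specialize (M2 (- y' - IZR z) (- y - IZR z)); specialize (HM n K); lra.
      * intros j i y y' Hj Hi H1 H2 H3.
        assert (B : - y - IZR z - (- y' - IZR z) <= m (- y - IZR z) - m (- y' - IZR z)).
        { apply (M3 (decode_str i)); try lra; apply In_test_stage; now exists j, i. }
        lra.
    + intros n; destruct (Hf n) as (j & i & HTj & Hp); exists j, i; split; auto.
      apply Int_part_cell in Hp; fold z in Hp.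
      destruct (edge i z) as (_ & _ & ? & ?); lra.
Qed.

(** * The infimum [D] and the three cases *)

Lemma crs_const_Q2R r : computable_rat (fun _ : nat => r) -> exists q, r = Q2R q.
Proof.
  intros (a & b & d & _ & _ & _ & E)%crs_inv; rewrite (E 0%nat).
  exists ((Z.of_nat (a 0%nat) - Z.of_nat (b 0%nat)) # Pos.of_succ_nat (d 0%nat))%Q.
  unfold Q2R, frac; cbn [Qnum Qden].
  now rewrite minus_IZR, <- !INR_IZR_INZ, Zpos_P_of_succ_nat, <- Nat2Z.inj_succ, <- INR_IZR_INZ.
Qed.

Lemma Dset_iff alpha beta r : Dset alpha beta r <->
  0 < r /\ computable_rat (fun _ : nat => r) /\ left_ce (r * alpha - beta).
Proof.
  assert (Q0 : Q2R 0 = 0) by (unfold Q2R; cbn; lra).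
  split.
  - intros (q & Hq & -> & H); repeat split; auto; [|crss].
    apply Qlt_Rlt in Hq; now rewrite Q0 in Hq.
  - intros (Hr & Hc & H); destruct (crs_const_Q2R r Hc) as [q ->]; exists q.
    repeat split; auto; apply Rlt_Qlt; now rewrite Q0.
Qed.

Lemma D_le alpha beta r : Dset alpha beta r -> Rbar_le (D alpha beta) r.
Proof. intros H; now apply (proj1 (Glb_Rbar_correct (Dset alpha beta))). Qed.

Lemma D_lt alpha beta c : Rbar_lt (D alpha beta) c -> exists r, Dset alpha beta r /\ Rbar_lt r c.
Proof.
  intros H; apply NNPP; intros Hno; apply (Rbar_lt_not_le _ _ H).
  apply (proj2 (Glb_Rbar_correct (Dset alpha beta))); intros r Hr.
  apply Rbar_not_lt_le; intros L; apply Hno; now exists r.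
Qed.

Lemma rational_between d : Rbar_lt 1 d ->
  exists p : R, computable_rat (fun _ : nat => p) /\ 1 < p /\ Rbar_lt p d.
Proof.
  destruct d as [d| |]; cbn; intros H; [|exists 2; repeat split; [crss | lra] | easy].
  destruct (pow_half_small (d - 1) ltac:(lra)) as [n Hn].
  pose proof (pow_lt (/ 2) n ltac:(lra)).
  exists (1 + (/ 2) ^ n); repeat split; [crss; cps | lra | cbn; lra].
Qed.

(** [Dset] is upward closed among rationals, since adding a nonnegative multiple of alpha keeps a
    real left-c.e. *)
Lemma left_ce_above_D alpha beta r : left_ce alpha -> computable_rat (fun _ : nat => r) ->
  Rbar_lt (D alpha beta) r -> left_ce (r * alpha - beta).
Proof.
  intros Ha Hr (r' & (_ & Hr' & H)%Dset_iff & L)%D_lt; cbn in L.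
  replace (r * alpha - beta) with ((r - r') * alpha + (r' * alpha - beta)) by ring.
  apply left_ce_plus; auto; apply left_ce_scal; auto; [crss | lra].
Qed.

(** If beta - q alpha is not left-c.e., then b - q a exceeds its limit infinitely often, so the
    ratio of the remaining distances is below q. As p is not in [Dset], that ratio is also
    infinitely often above p. *)
Lemma left_ce_below_D alpha beta p q : ML_random alpha -> left_ce alpha -> left_ce beta ->
  computable_rat (fun _ : nat => p) -> computable_rat (fun _ : nat => q) -> 0 < q < p ->
  Rbar_lt p (D alpha beta) -> left_ce (beta - q * alpha).
Proof.
  intros HR (a & Ha & Ma & Ca)%left_ce_crs (b & Hb & Mb & Cb)%left_ce_crs Hp Hq Hqp HD.
  apply NNPP; intros Hno.
  apply (no_oscillation alpha a b beta p q); auto.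
  - apply crs_const_inv; auto; lra.
  - intros N; apply NNPP; intros H; apply Hno, (left_ce_below (fun n => b n - q * a n)).
    + crss.
    + apply CV_minus; auto; now apply cv_scal.
    + exists N; intros n Hn; apply Rnot_lt_le; intros L; apply H; exists n; split; auto; lra.
  - intros N; apply NNPP; intros H; apply (Rbar_lt_not_le _ _ HD), D_le, Dset_iff.
    repeat split; [lra | auto |].
    apply (left_ce_below (fun n => p * a n - b n)).
    + crss.
    + apply CV_minus; auto; now apply cv_scal.
    + exists N; intros n Hn; apply Rnot_lt_le; intros L; apply H; exists n; split; auto; lra.
Qed.

Theorem theorem1p6 (alpha beta : R) :
  ML_random alpha -> left_ce alpha ->
  ML_random beta -> left_ce beta ->
  (Rbar_lt (D alpha beta) (Finite 1) ->
     ML_random (alpha - beta) /\ left_ce (alpha - beta)) /\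
  (D alpha beta = Finite 1 -> ~ ML_random (alpha - beta)) /\
  (Rbar_lt (Finite 1) (D alpha beta) ->
     ML_random (alpha - beta) /\ right_ce (alpha - beta)).
Proof.
  intros HR Ha _ Hb; split; [|split].
  (* With r < 1 in [Dset], alpha - beta is (1 - r) alpha plus the left-c.e. real r alpha - beta. *)
  - intros (r & (r_pos & Hr & H)%Dset_iff & L)%D_lt; cbn in L.
    replace (r * alpha - beta) with (alpha - beta - (1 - r) * alpha) in H by ring.
    assert (Hr1 : computable_rat (fun _ : nat => 1 - r)) by crss.
    split; [apply (random_plus alpha (alpha - beta) (1 - r)); auto; lra|].
    replace (alpha - beta) with ((1 - r) * alpha + (alpha - beta - (1 - r) * alpha)) by ring.
    apply left_ce_plus; auto; apply left_ce_scal; auto; lra.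
  - intros HD HRd.
    (* The constant c = 2^(k+1) is at least 2, so that 1 - 1/c below is positive. *)
    assert (pow_ge : forall k, 2 <= 2 ^ S k)
      by (intros k; pose proof (pow_R1_Rle 2 k ltac:(lra)); cbn; lra).
    assert (crs_c : forall k, computable_rat (fun _ : nat => / 2 ^ S k)).
    { intros k; apply crs_const_inv; [crss; cps | specialize (pow_ge k); lra]. }
    destruct (random_difference alpha beta Ha Hb HRd) as [H|H%right_ce_opp].
    (* Dividing c (alpha - beta) - alpha by c puts 1 - 1/c into [Dset], against D = 1. *)
    + destruct (kucera_slaman (alpha - beta) alpha) as [k Hk]; auto.
      specialize (pow_ge k); specialize (crs_c k); set (c := 2 ^ S k) in *.
      assert (ci : 0 < / c <= / 2)
        by (split; [apply Rinv_0_lt_compat | apply Rinv_le_contravar]; lra).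
      assert (Rbar_le (D alpha beta) (1 - / c)) as L; [|rewrite HD in L; change (1 <= 1 - / c) in L; lra].
      apply D_le, Dset_iff; repeat split; [lra | crss |].
      replace ((1 - / c) * alpha - beta) with (/ c * (c * (alpha - beta) - alpha)) by (field; lra).
      apply left_ce_scal; auto; lra.
    (* Now c (beta - alpha) - alpha is left-c.e., and by D = 1 so is c (r alpha - beta) for r = 1 +
       1/(2c). They add up to - alpha / 2, so alpha would be computable. *)
    + destruct (kucera_slaman (- (alpha - beta)) alpha) as [k Hk]; auto.
      { right; now rewrite Ropp_involutive. }
      specialize (pow_ge k); specialize (crs_c k); set (c := 2 ^ S k) in *.
      assert (ci : 0 < / c) by (apply Rinv_0_lt_compat; lra).
      assert (crs_r : computable_rat (fun _ : nat => 1 + / 2 * / c)) by crss.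
      assert (Hr : left_ce ((1 + / 2 * / c) * alpha - beta)).
      { apply left_ce_above_D; auto; rewrite HD; change (1 < 1 + / 2 * / c).
        pose proof (Rmult_lt_0_compat (/ 2) (/ c) ltac:(lra) ci); lra. }
      revert HR; apply computable_not_random; auto; apply right_ce_opp.
      replace (- alpha) with (2 * (c * (- (alpha - beta)) - alpha
        + c * ((1 + / 2 * / c) * alpha - beta))) by (field; lra).
      apply left_ce_scal; [crss | lra |]; apply left_ce_plus; auto.
      apply left_ce_scal; auto; [unfold c; crss; cps | lra].
  - intros (p & Hp & Hp1 & HD)%rational_between.
    (* The midpoint q of 1 and p satisfies 1 < q < p, so beta - alpha is a positive multiple of
       alpha plus a left-c.e. real. *)
    assert (Hq : computable_rat (fun _ : nat => (1 + p) * / 2)) by crss.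
    assert (H : left_ce (beta - (1 + p) * / 2 * alpha)).
    { apply (left_ce_below_D alpha beta p); auto; lra. }
    set (q := (1 + p) * / 2) in *.
    assert (Hq1 : computable_rat (fun _ : nat => q - 1)) by crss.
    replace (beta - q * alpha) with (beta - alpha - (q - 1) * alpha) in H by ring.
    replace (alpha - beta) with (- (beta - alpha)) by ring.
    split; [apply (random_plus alpha (beta - alpha) (q - 1)); auto; unfold q; lra|].
    apply right_ce_opp; rewrite Ropp_involutive.
    replace (beta - alpha) with ((q - 1) * alpha + (beta - alpha - (q - 1) * alpha)) by ring.
    apply left_ce_plus; auto; apply left_ce_scal; auto; unfold q; lra.
Qed.
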